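(* Let $a<0$ and $b\neq 0$ be real numbers. Every rotational linear Weingarten surface in $\mathbb{R}^3$ satisfying $\kappa_1=a\kappa_2+b$ is of one of the following types: unduloid-type, circular cylinder, sphere, nodoid-type.
   Context: The rotational axis is the $z$-axis and the generating curve $\gamma(s)=(x(s),0,z(s))$ lies in the $xz$-plane, is parametrized by arc length, has $x>0$, and $x'=\cos\theta$, $z'=\sin\theta$. The principal curvatures of the surface of revolution are $\kappa_1=\theta'$ (curvature of the profile curve) and $\kappa_2=\sin\theta/x$ (normal curvature of the orbits of the rotation), so the relation $\kappa_1=a\kappa_2+b$ is equivalent to the system $$x'=\cos\theta,\quad z'=\sin\theta,\quad \theta'=a\frac{\sin\theta}{x}+b.$$ The generating curves considered are the maximal solutions of this system, for arbitrary initial values $x(0)=x_0>0$, $z(0)=0$, $\theta(0)=\theta_0\in[0,2\pi)$; if such a curve tends to a point of the $z$-axis, that point is added to the curve and to the surface. Types of surfaces: - Unduloid-type surface: embedded surface not meeting the axis which is periodic in the direction of the axis. - Nodoid-type surface: non-embedded surface not meeting the axis, periodic in the direction of the axis, whose generating curve has loops towards the axis. - Circular cylinder: the generating curve is a straight line parallel to the axis. - Sphere: round sphere centered on the axis. *)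

(* Defs.v *)
From Stdlib Require Import Reals.
From Coquelicot Require Import Coquelicot.
Open Scope R_scope.

(* An arc [s |-> (x s, 0, z s)] with tangent angle [theta] on the open,
   possibly unbounded, interval (lo, hi); the values of the three functions
   outside (lo, hi) are irrelevant. *)
Record profile : Type := Profile {
  lo : Rbar;
  hi : Rbar;
  px : R -> R;
  pz : R -> R;
  ptheta : R -> R
}.

Definition dom (g : profile) (s : R) : Prop :=
  Rbar_lt (lo g) s /\ Rbar_lt s (hi g).

Definition kappa1 (g : profile) (s : R) : R := Derive (ptheta g) s.

Definition kappa2 (g : profile) (s : R) : R := sin (ptheta g s) / px g s.

Definition weingarten_solution (a b : R) (g : profile) : Prop :=
  forall s : R, dom g s ->
    0 < px g s /\
    is_derive (px g) s (cos (ptheta g s)) /\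
    is_derive (pz g) s (sin (ptheta g s)) /\
    ex_derive (ptheta g) s /\
    kappa1 g s = a * kappa2 g s + b.

Definition extends (g h : profile) : Prop :=
  Rbar_le (lo h) (lo g) /\ Rbar_le (hi g) (hi h) /\
  forall s : R, dom g s ->
    px h s = px g s /\ pz h s = pz g s /\ ptheta h s = ptheta g s.

Definition maximal_solution (a b : R) (g : profile) : Prop :=
  weingarten_solution a b g /\
  forall h : profile, weingarten_solution a b h -> extends g h ->
    lo h = lo g /\ hi h = hi g.

Definition generating_curve (a b x0 theta0 : R) (g : profile) : Prop :=
  dom g 0 /\ maximal_solution a b g /\
  px g 0 = x0 /\ pz g 0 = 0 /\ ptheta g 0 = theta0.

(* The curve tends to the point (0, 0, c) of the axis at the end [e] of its
   parameter interval. *)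
Definition tends_to_axis (g : profile) (e : Rbar) (c : R) : Prop :=
  filterlim (px g) (within (dom g) (Rbar_locally' e)) (locally 0) /\
  filterlim (pz g) (within (dom g) (Rbar_locally' e)) (locally c).

(* Trace of the curve in the (x, z)-plane, limit points on the axis added. *)
Definition on_curve (g : profile) (q : R * R) : Prop :=
  (exists s : R, dom g s /\ q = (px g s, pz g s)) \/
  (exists c : R,
     (tends_to_axis g (lo g) c \/ tends_to_axis g (hi g) c) /\ q = (0, c)).

Definition S1 (w : R * R) : Prop := fst w ^ 2 + snd w ^ 2 = 1.

Definition on_surface (g : profile) (p : R * R * R) : Prop :=
  exists (q w : R * R), on_curve g q /\ S1 w /\
    p = (fst q * fst w, fst q * snd w, snd q).

(* The rotational immersion of (lo, hi) x S^1 into R^3. It covers the whole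
   surface exactly when no point of the axis has been added. *)
Definition immersion (g : profile) (q : R * (R * R)) : R * R * R :=
  (px g (fst q) * fst (snd q), px g (fst q) * snd (snd q), pz g (fst q)).

Definition immersion_dom (g : profile) (q : R * (R * R)) : Prop :=
  dom g (fst q) /\ S1 (snd q).

(* Injective, with continuous inverse on the image. Continuity and regularity
   of the immersion are automatic for solutions, since px > 0 and the curve has
   unit speed. *)
Definition embedded (g : profile) : Prop :=
  (forall q q' : R * (R * R), immersion_dom g q -> immersion_dom g q' ->
     immersion g q = immersion g q' -> q = q') /\
  (forall q : R * (R * R), immersion_dom g q ->
     forall eps : posreal, exists delta : posreal,
       forall q' : R * (R * R), immersion_dom g q' ->
         ball (immersion g q) delta (immersion g q') -> ball q eps q').

Definition misses_axis (g : profile) : Prop :=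
  forall u v w : R, on_surface g (u, v, w) -> ~ (u = 0 /\ v = 0).

(* A nontrivial translation along the axis maps the immersed surface to itself,
   shifting the arc-length parameter by one period. *)
Definition axially_periodic (g : profile) : Prop :=
  exists L T : R, 0 < L /\ T <> 0 /\
    forall s : R, dom g s ->
      dom g (s + L) /\ dom g (s - L) /\
      forall w : R * R, S1 w ->
        immersion g (s + L, w) =
          (let '(p1, p2, p3) := immersion g (s, w) in (p1, p2, p3 + T)).

(* A simple closed subarc lying strictly nearer to the axis than the double
   point at which it closes up. *)
Definition loop_towards_axis (g : profile) (s1 s2 : R) : Prop :=
  dom g s1 /\ dom g s2 /\ s1 < s2 /\
  (px g s1, pz g s1) = (px g s2, pz g s2) /\
  (forall s t : R, s1 <= s -> s < t -> t <= s2 ->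
     (px g s, pz g s) = (px g t, pz g t) -> s = s1 /\ t = s2) /\
  (forall s : R, s1 < s < s2 -> px g s < px g s1).

Definition unduloid_type (g : profile) : Prop :=
  embedded g /\ misses_axis g /\ axially_periodic g.

(* One loop suffices here: periodicity repeats it along the axis. *)
Definition nodoid_type (g : profile) : Prop :=
  ~ embedded g /\ misses_axis g /\ axially_periodic g /\
  exists s1 s2 : R, loop_towards_axis g s1 s2.

Definition circular_cylinder (g : profile) : Prop :=
  exists r : R, 0 < r /\ forall u w : R, on_curve g (u, w) <-> u = r.

Definition round_sphere (g : profile) : Prop :=
  exists c r : R, 0 < r /\
    forall u v w : R,
      on_surface g (u, v, w) <-> u ^ 2 + v ^ 2 + (w - c) ^ 2 = r ^ 2.

(* Main.v *)
Require Import Defs.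
From Stdlib Require Import Reals Lra Lia FunctionalExtensionality Classical.
From Coquelicot Require Import Coquelicot.
Open Scope R_scope.

(* Write be = b / (1 - a). The quantity x^(-a) (sin theta - be x) is constant along a solution. If it
   vanishes, then theta' = be and the curve is a half circle centered on the axis. Otherwise x is
   bounded away from 0, so a maximal solution is defined on all of R (local existence from Picard's
   theorem and uniqueness from Gronwall's inequality). Uniqueness also makes the curve symmetric
   about every point with cos theta = 0, so that two such points give a period; the shift along the
   axis is nonzero because b z + cos theta has derivative -a sin^2 theta / x >= 0.
   If the constant is positive, sin theta is bounded below by a positive number, z is increasing, and
   cos theta vanishes infinitely often: the curve is of unduloid type. The cylinder needs no separate
   treatment, since it satisfies the definition of unduloid type. If the constant is negative,
   theta' > be, and the arc around a point where theta = -pi/2 closes up to a loop.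
   The case b < 0 follows by reflection in the plane z = 0. *)

(** * Picard's theorem for planar Lipschitz systems *)

(** With [be = b / (1 - a)] the equation reads kappa_1 - be = a (kappa_2 - be): [be] is the
    curvature of the sphere that solves it, and since a < 0 the sign of kappa_2 - be, fixed by the
    first integral, decides on which side of [be] the turning rate theta' lies. The lower bound on x
    also rests on a < 0: x^(-a) tends to 0 with x while the other factor stays bounded, which a
    nonzero constant forbids. Maximality is known only through extensions of profiles, and the
    system is singular at x = 0. Picard's theorem is therefore applied to a truncated, globally
    Lipschitz system, with an existence time depending only on a lower bound for x; one such step
    past a finite end contradicts maximality. The positive case is the delicate one for the period:
    theta is confined to an interval of length pi, so the zeros of cos theta cannot come from a
    sweep through all angles and are obtained by contradiction. *)

Lemma filter_imp_2 {T : Type} {F : (T -> Prop) -> Prop} {FF : Filter F} (A B C : T -> Prop) :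
  (forall x, A x -> B x -> C x) -> F A -> F B -> F C.
Proof.
  intros H HA HB; apply (filter_imp (fun x => A x /\ B x)); [intuition|].
  now apply filter_and.
Qed.

Lemma is_derive_mvt (f df : R -> R) (p q : R) :
  p < q -> (forall t, p <= t <= q -> is_derive f t (df t)) ->
  exists r, p < r < q /\ f q - f p = df r * (q - p).
Proof.
  intros Hpq Hd.
  destruct (MVT_cor2 f df p q Hpq) as [r [Hr1 Hr2]].
  - intros c Hc; now apply is_derive_Reals, Hd.
  - now exists r.
Qed.

Lemma derive_nonneg_incr (f df : R -> R) (p q : R) :
  p <= q -> (forall t, p <= t <= q -> is_derive f t (df t)) ->
  (forall t, p <= t <= q -> 0 <= df t) -> f p <= f q.
Proof.
  intros [Hpq | ->] Hd H0; [|lra].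
  destruct (is_derive_mvt f df p q Hpq Hd) as [r [Hr E]].
  specialize (H0 r ltac:(lra)); nra.
Qed.

Lemma derive_pos_incr (f df : R -> R) (p q : R) :
  p < q -> (forall t, p <= t <= q -> is_derive f t (df t)) ->
  (forall t, p < t < q -> 0 < df t) -> f p < f q.
Proof.
  intros Hpq Hd H0.
  destruct (is_derive_mvt f df p q Hpq Hd) as [r [Hr E]].
  specialize (H0 r Hr); nra.
Qed.

(** Stated for [p] and [q] in either order; with [B = 0] it is how quantities are shown to be
    conserved below. *)
Lemma Rabs_mvt (f df : R -> R) (B p q : R) :
  (forall t, Rmin p q <= t <= Rmax p q -> is_derive f t (df t)) ->
  (forall t, Rmin p q <= t <= Rmax p q -> Rabs (df t) <= B) ->
  Rabs (f q - f p) <= B * Rabs (q - p).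
Proof.
  intros Hd HB.
  destruct (MVT_gen f p q df) as [c [Hc ->]].
  - intros x Hx; apply Hd; lra.
  - intros x Hx; apply continuity_pt_filterlim.
    apply (ex_derive_continuous f); exists (df x); now apply Hd.
  - rewrite Rabs_mult; apply Rmult_le_compat_r; [apply Rabs_pos | now apply HB].
Qed.

(** Clamping the upper limit of the Picard integral makes every iterate a continuous function on all
    of R, with contraction estimates uniform in t, although the equation is solved only for |t| <
    d. *)
Definition clamp (d t : R) : R := Rmax (- d) (Rmin d t).

Lemma Rabs_clamp_le (d t : R) : 0 < d -> Rabs (clamp d t) <= d.
Proof.
  intros; unfold clamp, Rmax, Rmin; apply Rabs_le.
  repeat destruct Rle_dec; lra.
Qed.

Lemma clamp_id (d t : R) : Rabs t < d -> clamp d t = t.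
Proof.
  intros H; apply Rabs_def2 in H; unfold clamp, Rmax, Rmin.
  repeat destruct Rle_dec; lra.
Qed.

Lemma continuous_clamp (d t : R) : continuous (clamp d) t.
Proof.
  apply filterlim_locally; intros eps; exists eps; intros s Hs.
  change (Rabs (clamp d s - clamp d t) < eps).
  change (Rabs (s - t) < eps) in Hs.
  apply Rle_lt_trans with (2 := Hs).
  unfold clamp, Rmax, Rmin; repeat destruct Rle_dec; unfold Rabs; repeat destruct Rcase_abs; lra.
Qed.

Lemma is_derive_primitive (f : R -> R) (c t : R) :
  (forall s, continuous f s) -> is_derive (fun t => c + RInt f 0 t) t (f t).
Proof.
  intros Hf.
  replace (f t) with (plus zero (f t)) by (unfold plus, zero; simpl; ring).
  apply (is_derive_plus (fun _ => c) (fun t => RInt f 0 t)).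
  - apply @is_derive_const.
  - apply is_derive_RInt with 0; [|apply Hf].
    exists (mkposreal 1 Rlt_0_1); intros u _.
    apply (RInt_correct f), (ex_RInt_continuous f); intros; apply Hf.
Qed.

Definition lipschitz2 (K : R) (P : R -> R -> R) : Prop :=
  forall x y x' y', Rabs (P x y - P x' y') <= K * (Rabs (x - x') + Rabs (y - y')).

Lemma continuous_lipschitz2 (K : R) (P : R -> R -> R) (u v : R -> R) (t : R) :
  0 < K -> lipschitz2 K P -> continuous u t -> continuous v t ->
  continuous (fun s => P (u s) (v s)) t.
Proof.
  intros HK HP Hu Hv; apply filterlim_locally; intros eps.
  assert (He : 0 < eps / (2 * K)) by (apply Rdiv_lt_0_compat; [apply cond_pos | lra]).
  generalize (proj1 (filterlim_locally _ _) Hu (mkposreal _ He)).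
  generalize (proj1 (filterlim_locally _ _) Hv (mkposreal _ He)).
  apply filter_imp_2; intros s Hvs Hus.
  change (Rabs (v s - v t) < eps / (2 * K)) in Hvs.
  change (Rabs (u s - u t) < eps / (2 * K)) in Hus.
  change (Rabs (P (u s) (v s) - P (u t) (v t)) < eps).
  apply Rle_lt_trans with (1 := HP _ _ _ _).
  apply Rlt_le_trans with (K * (eps / (2 * K) + eps / (2 * K))).
  - apply Rmult_lt_compat_l; lra.
  - apply Req_le; field; lra.
Qed.

Definition picard_step (d c : R) (f : R -> R) (t : R) : R := c + RInt f 0 (clamp d t).

Lemma continuous_picard_step (d c : R) (f : R -> R) :
  (forall t, continuous f t) -> forall t, continuous (picard_step d c f) t.
Proof.
  intros Hf t.
  apply (continuous_comp (clamp d) (fun t => c + RInt f 0 t)); [apply continuous_clamp|].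
  apply (ex_derive_continuous (fun t => c + RInt f 0 t)); eexists; now apply is_derive_primitive.
Qed.

Lemma picard_step_contract (d c B : R) (f g : R -> R) :
  0 < d -> (forall t, continuous f t) -> (forall t, continuous g t) ->
  (forall t, Rabs (f t - g t) <= B) ->
  forall t, Rabs (picard_step d c f t - picard_step d c g t) <= d * B.
Proof.
  intros Hd Hf Hg HB t.
  assert (HB0 : 0 <= B) by (apply Rle_trans with (2 := HB 0); apply Rabs_pos).
  unfold picard_step.
  set (h := fun t => (c + RInt f 0 t) - (c + RInt g 0 t)).
  assert (E : c + RInt f 0 (clamp d t) - (c + RInt g 0 (clamp d t)) = h (clamp d t) - h 0).
  { unfold h; rewrite !RInt_point; unfold zero; simpl; ring. }
  rewrite E.
  apply Rle_trans with (B * Rabs (clamp d t - 0)).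
  - apply (Rabs_mvt h (fun t => f t - g t)).
    + intros s _; apply (is_derive_minus (fun t => c + RInt f 0 t) (fun t => c + RInt g 0 t));
        now apply is_derive_primitive.
    + intros s _; apply HB.
  - rewrite Rminus_0_r, Rmult_comm; apply Rmult_le_compat_r; [exact HB0|].
    now apply Rabs_clamp_le.
Qed.

Fixpoint picard (d x0 y0 : R) (P Q : R -> R -> R) (n : nat) : (R -> R) * (R -> R) :=
  match n with
  | O => (fun _ => x0, fun _ => y0)
  | S n =>
      let (u, v) := picard d x0 y0 P Q n in
      (picard_step d x0 (fun s => P (u s) (v s)), picard_step d y0 (fun s => Q (u s) (v s)))
  end.

Lemma CVU_cauchy_geometric (f : nat -> R -> R) (M : R) :
  0 < M ->
  (forall n t, Rabs (f (S n) t - f n t) <= M * (1 / 2) ^ n) ->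
  CVU_cauchy f (fun _ => True).
Proof.
  intros HM Hf.
  (* The exact geometric sum, rather than the bound 2 M / 2^n alone, lets the induction on [k]
     close. *)
  assert (Hk : forall k n t, Rabs (f (n + k)%nat t - f n t) <= 2 * M * (1 / 2) ^ n - 2 * M * (1 / 2) ^ (n + k)).
  { induction k as [|k IH]; intros n t.
    - rewrite Nat.add_0_r, Rminus_diag, Rabs_R0; lra.
    - rewrite Nat.add_succ_r.
      replace (f (S (n + k)) t - f n t)
        with ((f (S (n + k)) t - f (n + k)%nat t) + (f (n + k)%nat t - f n t)) by ring.
      apply Rle_trans with (1 := Rabs_triang _ _).
      specialize (IH n t); specialize (Hf (n + k)%nat t).
      simpl pow; lra. }
  assert (Hpos : forall n, 0 < (1 / 2) ^ n) by (intros; apply pow_lt; lra).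
  intros eps.
  destruct (pow_lt_1_zero (1 / 2) ltac:(apply Rabs_def1; lra) (eps / (4 * M))) as [N HN].
  { apply Rdiv_lt_0_compat; [apply cond_pos | lra]. }
  assert (HN' : 4 * M * (1 / 2) ^ N < eps).
  { specialize (HN N (le_n N)); rewrite Rabs_pos_eq in HN by (left; apply Hpos).
    apply Rmult_lt_compat_l with (r := 4 * M) in HN; [|lra].
    replace (4 * M * (eps / (4 * M))) with (pos eps) in HN by (field; lra); exact HN. }
  exists N; intros n m t _ Hn Hm.
  assert (H : forall p, (N <= p)%nat -> Rabs (f p t - f N t) < 2 * M * (1 / 2) ^ N).
  { intros p Hp; replace p with (N + (p - N))%nat by lia.
    apply Rle_lt_trans with (1 := Hk _ _ _).
    generalize (Hpos (N + (p - N))%nat); nra. }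
  generalize (H n Hn) (H m Hm); unfold Rabs; repeat destruct Rcase_abs; lra.
Qed.

Lemma CVU_dom_True_lim (f : nat -> R -> R) (t : R) :
  CVU_dom f (fun _ => True) -> is_lim_seq (fun n => f n t) (real (Lim_seq (fun n => f n t))).
Proof.
  intros H; apply is_lim_seq_spec; intros eps; destruct (H eps) as [N HN].
  exists N; intros n Hn; now apply HN.
Qed.

(** The sequence [w (S n)] tends to [W] as a shift of [w], and to the Picard step of the limits by
    contraction, so the two limits agree. Keeping [w] apart from [u] and [v] lets one lemma serve
    both components. *)
Lemma picard_step_fixpoint (d c K : R) (P : R -> R -> R) (u v w : nat -> R -> R) (U V W : R -> R) :
  0 < d -> 0 < K -> lipschitz2 K P ->
  (forall n t, continuous (u n) t) -> (forall n t, continuous (v n) t) ->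
  (forall t, continuous U t) -> (forall t, continuous V t) ->
  (forall eps : posreal, eventually (fun n => forall t : R, True -> Rabs (u n t - U t) < eps)) ->
  (forall eps : posreal, eventually (fun n => forall t : R, True -> Rabs (v n t - V t) < eps)) ->
  (forall t, is_lim_seq (fun n => w n t) (W t)) ->
  (forall n, w (S n) = picard_step d c (fun s => P (u n s) (v n s))) ->
  forall t, W t = picard_step d c (fun s => P (U s) (V s)) t.
Proof.
  intros Hd HK HP Hu Hv HU HV CU CV HW Hw t.
  assert (HL : is_lim_seq (fun n => w (S n) t) (picard_step d c (fun s => P (U s) (V s)) t)).
  { apply is_lim_seq_spec; intros eps.
    assert (He : 0 < eps / (4 * K * d)).
    { apply Rdiv_lt_0_compat; [apply cond_pos | nra]. }
    generalize (CU (mkposreal _ He)) (CV (mkposreal _ He)).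
    apply filter_imp_2; intros n Hun Hvn; simpl in Hun, Hvn; rewrite Hw.
    apply Rle_lt_trans with (d * (K * (2 * (eps / (4 * K * d))))).
    - apply picard_step_contract; auto; try (intros; apply continuous_lipschitz2 with K; auto).
      intros s; apply Rle_trans with (1 := HP _ _ _ _).
      apply Rmult_le_compat_l; [lra|]; specialize (Hun s I); specialize (Hvn s I); lra.
    - replace (d * (K * (2 * (eps / (4 * K * d))))) with (eps / 2) by (field; lra).
      generalize (cond_pos eps); lra. }
  assert (HW' := proj1 (is_lim_seq_incr_1 (fun n => w n t) (W t)) (HW t)).
  apply is_lim_seq_unique in HL; apply is_lim_seq_unique in HW'.
  rewrite HL in HW'; now injection HW'.
Qed.

Lemma is_derive_picard_step (d c : R) (f W : R -> R) (t : R) :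
  (forall s, continuous f s) -> (forall s, W s = picard_step d c f s) ->
  Rabs t < d -> is_derive W t (f t).
Proof.
  intros Hf HW Ht.
  apply is_derive_ext_loc with (fun t => c + RInt f 0 t); [|now apply is_derive_primitive].
  assert (He : 0 < d - Rabs t) by lra.
  exists (mkposreal _ He); intros s Hs; change (Rabs (s - t) < d - Rabs t) in Hs.
  rewrite HW; unfold picard_step; rewrite clamp_id; [reflexivity|].
  replace s with ((s - t) + t) by ring; apply Rle_lt_trans with (1 := Rabs_triang _ _); lra.
Qed.

(** The Lipschitz bound adds the errors of two components, so one step multiplies their common bound
    by 2 K d, which [4 * K * d <= 1] makes at most 1/2. *)
Theorem picard_lindelof (K d : R) (P Q : R -> R -> R) :
  0 < K -> 0 < d -> 4 * K * d <= 1 -> lipschitz2 K P -> lipschitz2 K Q ->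
  forall x0 y0 : R, exists u v : R -> R,
    u 0 = x0 /\ v 0 = y0 /\
    forall t, Rabs t < d ->
      is_derive u t (P (u t) (v t)) /\ is_derive v t (Q (u t) (v t)).
Proof.
  intros HK Hd HKd HP HQ x0 y0.
  set (p := picard d x0 y0 P Q).
  set (u := fun n => fst (p n)); set (v := fun n => snd (p n)).
  assert (Hu : forall n, u (S n) = picard_step d x0 (fun s => P (u n s) (v n s))).
  { intros n; unfold u, v, p; simpl; now destruct (picard d x0 y0 P Q n). }
  assert (Hv : forall n, v (S n) = picard_step d y0 (fun s => Q (u n s) (v n s))).
  { intros n; unfold u, v, p; simpl; now destruct (picard d x0 y0 P Q n). }
  assert (Huv : forall n t, continuous (u n) t /\ continuous (v n) t).
  { induction n as [|n IH]; intros t.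
    - split; apply (continuous_const (U := R_UniformSpace)).
    - rewrite Hu, Hv; split; apply continuous_picard_step; intros s;
        apply continuous_lipschitz2 with K; auto; apply IH. }
  assert (Hcu : forall n t, continuous (u n) t) by (intros; apply Huv).
  assert (Hcv : forall n t, continuous (v n) t) by (intros; apply Huv).
  assert (Hgeo : exists M, 0 < M /\ forall n t,
    Rabs (u (S n) t - u n t) <= M * (1 / 2) ^ n /\ Rabs (v (S n) t - v n t) <= M * (1 / 2) ^ n).
  (* The first iterate moves each component by at most d times the size of the field at the initial
     point; the [+ 1] keeps [M] positive when the field vanishes there. *)
  { exists (d * (Rabs (P x0 y0) + Rabs (Q x0 y0) + 1)).
    generalize (Rabs_pos (P x0 y0)) (Rabs_pos (Q x0 y0)); intros HP0 HQ0.
    split; [nra|].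
    induction n as [|n IH]; intros t.
    - rewrite Hu, Hv; simpl pow; rewrite Rmult_1_r.
      assert (Hz : forall c B (f : R -> R), (forall s, continuous f s) -> (forall s, Rabs (f s) <= B) ->
        Rabs (picard_step d c f t - c) <= d * B).
      { intros c B f Hf HB.
        replace (Rabs (picard_step d c f t - c))
          with (Rabs (picard_step d c f t - picard_step d c (fun _ => 0) t)).
        - apply picard_step_contract; auto.
          + intros; apply (continuous_const (U := R_UniformSpace)).
          + intros s; now rewrite Rminus_0_r.
        - f_equal; unfold picard_step; rewrite RInt_const; unfold scal; simpl; unfold mult; simpl; ring. }
      split; apply Hz; unfold u, v, p; simpl; try (intros; apply (continuous_const (U := R_UniformSpace))); intros; lra.
    - set (M := d * (Rabs (P x0 y0) + Rabs (Q x0 y0) + 1)) in *.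
      assert (HM : 0 < M) by (unfold M; nra).
      assert (Hstep : forall F, lipschitz2 K F -> forall c,
        Rabs (picard_step d c (fun s => F (u (S n) s) (v (S n) s)) t
              - picard_step d c (fun s => F (u n s) (v n s)) t) <= M * (1 / 2) ^ S n).
      { intros F HF c.
        apply Rle_trans with (d * (K * (2 * (M * (1 / 2) ^ n)))).
        - apply picard_step_contract; auto; try (intros; apply continuous_lipschitz2 with K; auto).
          intros s; apply Rle_trans with (1 := HF _ _ _ _).
          apply Rmult_le_compat_l; [lra|]; destruct (IH s); lra.
        - assert (0 < (1 / 2) ^ n) by (apply pow_lt; lra).
          assert (0 < M * (1 / 2) ^ n) by nra.
          simpl pow; nra. }
      split; [generalize (Hstep P HP x0); rewrite <- !Hu | generalize (Hstep Q HQ y0); rewrite <- !Hv];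
        auto. }
  destruct Hgeo as [M [HM Hgeo]].
  assert (CU : CVU_dom u (fun _ => True)).
  { apply CVU_dom_cauchy, CVU_cauchy_geometric with M; auto; intros; apply Hgeo. }
  assert (CV : CVU_dom v (fun _ => True)).
  { apply CVU_dom_cauchy, CVU_cauchy_geometric with M; auto; intros; apply Hgeo. }
  set (U := fun t => real (Lim_seq (fun n => u n t))).
  set (V := fun t => real (Lim_seq (fun n => v n t))).
  assert (HU : forall t, continuous U t).
  { intros t; apply continuity_pt_filterlim.
    apply (CVU_cont_open u (fun _ => True)); auto using open_true.
    intros n x _; apply continuity_pt_filterlim, Hcu. }
  assert (HV : forall t, continuous V t).
  { intros t; apply continuity_pt_filterlim.
    apply (CVU_cont_open v (fun _ => True)); auto using open_true.
    intros n x _; apply continuity_pt_filterlim, Hcv. }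
  assert (EU : forall t, U t = picard_step d x0 (fun s => P (U s) (V s)) t).
  { apply (picard_step_fixpoint d x0 K P u v u U V U); auto.
    intros t; now apply CVU_dom_True_lim. }
  assert (EV : forall t, V t = picard_step d y0 (fun s => Q (U s) (V s)) t).
  { apply (picard_step_fixpoint d y0 K Q u v v U V V); auto.
    intros t; now apply CVU_dom_True_lim. }
  assert (E0 : clamp d 0 = 0) by (apply clamp_id; rewrite Rabs_R0; lra).
  exists U, V; split; [|split; [|intros t Ht; split]].
  - rewrite EU; unfold picard_step; rewrite E0, RInt_point; unfold zero; simpl; ring.
  - rewrite EV; unfold picard_step; rewrite E0, RInt_point; unfold zero; simpl; ring.
  - apply (is_derive_picard_step d x0 (fun s => P (U s) (V s)) U t); auto.
    intros; apply continuous_lipschitz2 with K; auto.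
  - apply (is_derive_picard_step d y0 (fun s => Q (U s) (V s)) V t); auto.
    intros; apply continuous_lipschitz2 with K; auto.
Qed.

(** * Local existence and uniqueness *)

(** The height z is left out because the right-hand side does not depend on it: x and theta form a
    planar system, and z is recovered by integration. *)
Definition solves (a b : R) (x th : R -> R) (s : R) : Prop :=
  0 < x s /\ is_derive x s (cos (th s)) /\ is_derive th s (a * (sin (th s) / x s) + b).

Lemma cos_lipschitz (y y' : R) : Rabs (cos y - cos y') <= Rabs (y - y').
Proof.
  rewrite <- (Rmult_1_l (Rabs (y - y'))).
  apply (Rabs_mvt cos (fun t => - sin t)).
  - intros; apply is_derive_Reals, derivable_pt_lim_cos.
  - intros; rewrite Rabs_Ropp; apply Rabs_le, SIN_bound.
Qed.

Lemma sin_lipschitz (y y' : R) : Rabs (sin y - sin y') <= Rabs (y - y').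
Proof.
  rewrite <- (Rmult_1_l (Rabs (y - y'))).
  apply (Rabs_mvt sin cos).
  - intros; apply is_derive_Reals, derivable_pt_lim_sin.
  - intros; apply Rabs_le, COS_bound.
Qed.

Lemma sin_div_lipschitz (q X X' y y' : R) :
  0 < q -> q <= X -> q <= X' ->
  Rabs (sin y / X - sin y' / X') <= Rabs (y - y') / q + Rabs (X - X') / q ^ 2.
Proof.
  intros Hq HX HX'.
  replace (sin y / X - sin y' / X')
    with ((sin y - sin y') * / X + sin y' * ((X' - X) * / (X * X'))) by (field; lra).
  apply Rle_trans with (1 := Rabs_triang _ _).
  rewrite !Rabs_mult.
  assert (HqX : / X <= / q) by (apply Rinv_le_contravar; lra).
  assert (HqXX : / (X * X') <= / q ^ 2) by (apply Rinv_le_contravar; nra).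
  assert (0 < / X) by (apply Rinv_0_lt_compat; lra).
  assert (0 < / (X * X')) by (apply Rinv_0_lt_compat; nra).
  rewrite (Rabs_pos_eq (/ X)), (Rabs_pos_eq (/ (X * X'))) by lra.
  rewrite (Rabs_minus_sym X' X).
  apply Rplus_le_compat; unfold Rdiv.
  - apply Rmult_le_compat; try apply Rabs_pos; [lra | apply sin_lipschitz | exact HqX].
  - rewrite <- (Rmult_1_l (Rabs (X - X') * / q ^ 2)).
    apply Rmult_le_compat; [apply Rabs_pos | | apply Rabs_le, SIN_bound | ].
    + apply Rmult_le_pos; [apply Rabs_pos | lra].
    + apply Rmult_le_compat_l; [apply Rabs_pos | exact HqXX].
Qed.

(** The length [d] depends on [c] only and not on the initial point, which is what continuation
    needs. Replacing x by [Rmax x q] with q = c / 2 makes the field globally Lipschitz; as |x'| <= 1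
    and d <= q, the solution never drops below q, where the truncation would act. *)
Lemma local_solution (a b c : R) :
  0 < c ->
  exists d, 0 < d /\
    forall s1 x1 th1, c <= x1 -> exists x th,
      x s1 = x1 /\ th s1 = th1 /\
      forall s, Rabs (s - s1) < d -> solves a b x th s /\ c / 2 <= x s.
Proof.
  intros Hc; set (q := c / 2); assert (Hq : 0 < q) by (unfold q; lra).
  assert (Hiq : 0 < / q) by now apply Rinv_0_lt_compat.
  set (A := Rabs a * / q + Rabs a * / q ^ 2).
  assert (HA1 : 0 <= Rabs a * / q) by (apply Rmult_le_pos; [apply Rabs_pos | lra]).
  assert (HA2 : 0 <= Rabs a * / q ^ 2).
  { apply Rmult_le_pos; [apply Rabs_pos | left; apply Rinv_0_lt_compat, pow_lt, Hq]. }
  (* The terms 1 and [A] are Lipschitz constants of the two components; [/ q] only serves to make d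
     = 1 / (4 K) at most q. *)
  set (K := 1 + A + / q); assert (HK : 0 < K) by (unfold K, A; lra).
  set (P := fun _ y : R => cos y).
  set (Q := fun x y : R => a * (sin y / Rmax x q) + b).
  assert (HP : lipschitz2 K P).
  { intros x y x' y'; unfold P; apply Rle_trans with (1 := cos_lipschitz y y').
    assert (1 <= K) by (unfold K, A; lra).
    generalize (Rabs_pos (x - x')) (Rabs_pos (y - y')); nra. }
  assert (HQ : lipschitz2 K Q).
  { intros x y x' y'; unfold Q.
    replace (a * (sin y / Rmax x q) + b - (a * (sin y' / Rmax x' q) + b))
      with (a * (sin y / Rmax x q - sin y' / Rmax x' q)) by ring.
    rewrite Rabs_mult.
    apply Rle_trans with (Rabs a * (Rabs (y - y') * / q + Rabs (x - x') * / q ^ 2)).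
    - apply Rmult_le_compat_l; [apply Rabs_pos|].
      apply Rle_trans with (1 := sin_div_lipschitz q _ _ y y' Hq (Rmax_r _ _) (Rmax_r _ _)).
      apply Rplus_le_compat_l, Rmult_le_compat_r; [left; apply Rinv_0_lt_compat, pow_lt, Hq|].
      unfold Rmax, Rabs; repeat destruct Rle_dec; repeat destruct Rcase_abs; lra.
    - generalize (Rabs_pos (x - x')) (Rabs_pos (y - y')); intros; unfold K, A; nra. }
  set (d := / (4 * K)); assert (Hd : 0 < d) by (apply Rinv_0_lt_compat; lra).
  assert (HKd : 4 * K * d <= 1) by (unfold d; right; field; lra).
  assert (Hdq : d <= q).
  { unfold d; rewrite <- (Rinv_inv q); apply Rinv_le_contravar; [lra|]; unfold K, A; lra. }
  exists d; split; [exact Hd|]; intros s1 x1 th1 Hx1.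
  destruct (picard_lindelof K d P Q HK Hd HKd HP HQ x1 th1) as [u [v [Hu0 [Hv0 Huv]]]].
  exists (fun s => u (s - s1)), (fun s => v (s - s1)).
  rewrite !Rminus_diag; split; [exact Hu0|]; split; [exact Hv0|].
  intros s Hs.
  assert (Hus : q <= u (s - s1)).
  { assert (H : Rabs (u (s - s1) - u 0) <= 1 * Rabs (s - s1 - 0)).
    { apply Rabs_mvt with (df := fun t => cos (v t)).
      - intros t Ht; apply (Huv t).
        revert Ht Hs; unfold Rmin, Rmax, Rabs; destruct Rle_dec; repeat destruct Rcase_abs; lra.
      - intros; apply Rabs_le, COS_bound. }
    rewrite Hu0, Rminus_0_r, Rmult_1_l in H.
    assert (H2 : x1 - u (s - s1) <= Rabs (u (s - s1) - x1)) by (rewrite Rabs_minus_sym; apply Rle_abs).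
    unfold q in *; lra. }
  destruct (Huv _ Hs) as [Du Dv].
  assert (Hshift : forall (f : R -> R) l, is_derive f (s - s1) l -> is_derive (fun s => f (s - s1)) s l).
  { intros f l Hf; evar_last.
    - apply (is_derive_comp f (fun s => s - s1)); [exact Hf|].
      apply (is_derive_minus (fun s => s) (fun _ => s1)); [apply @is_derive_id | apply @is_derive_const].
    - unfold scal, minus, plus, opp, one, zero; simpl; unfold mult; simpl; ring. }
  split; [|exact Hus]; split; [lra|]; split; apply Hshift.
  - exact Du.
  - unfold Q in Dv; rewrite Rmax_left in Dv by exact Hus; exact Dv.
Qed.

(** To the right of [s0] the function exp(-K t) D decreases, and to the left exp(K t) D increases
    towards [s0]; either way D is squeezed between 0 and 0. *)
Lemma gronwall_zero (K s0 s : R) (D dD : R -> R) :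
  (forall t, Rmin s0 s <= t <= Rmax s0 s ->
     is_derive D t (dD t) /\ 0 <= D t /\ Rabs (dD t) <= K * D t) ->
  D s0 = 0 -> D s = 0.
Proof.
  intros H D0.
  assert (Hexp : forall k t, Rmin s0 s <= t <= Rmax s0 s ->
    is_derive (fun t => exp (k * t) * D t) t (exp (k * t) * (k * D t + dD t))).
  { intros k t Ht; evar_last.
    - apply (is_derive_mult (fun t => exp (k * t)) D); [auto_derive; auto | apply H, Ht | apply Rmult_comm].
    - unfold plus, mult; simpl; ring. }
  assert (Hs : 0 <= D s) by (apply H; split; [apply Rmin_r | apply Rmax_r]).
  destruct (Rle_dec s0 s) as [Hle | Hgt].
  - rewrite Rmin_left, Rmax_right in * by lra.
    assert (E : - (exp (- K * s0) * D s0) <= - (exp (- K * s) * D s)).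
    { apply (derive_nonneg_incr (fun t => - (exp (- K * t) * D t))
        (fun t => - (exp (- K * t) * (- K * D t + dD t)))); [exact Hle | | ].
      - intros t Ht; apply @is_derive_opp, Hexp, Ht.
      - intros t Ht; destruct (H t Ht) as [_ [_ Hd]].
        apply Rabs_le_between in Hd; generalize (exp_pos (- K * t)); nra. }
    generalize (exp_pos (- K * s)); rewrite D0 in E; nra.
  - rewrite Rmin_right, Rmax_left in * by lra.
    assert (E : exp (K * s) * D s <= exp (K * s0) * D s0).
    { apply (derive_nonneg_incr (fun t => exp (K * t) * D t)
        (fun t => exp (K * t) * (K * D t + dD t))); [lra | | ].
      - intros t Ht; apply Hexp, Ht.
      - intros t Ht; destruct (H t Ht) as [_ [_ Hd]].
        apply Rabs_le_between in Hd; generalize (exp_pos (K * t)); nra. }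
    generalize (exp_pos (K * s)); rewrite D0 in E; nra.
Qed.

Lemma solves_unique (a b c s0 s : R) (x th x' th' : R -> R) :
  0 < c ->
  (forall t, Rmin s0 s <= t <= Rmax s0 s ->
     solves a b x th t /\ solves a b x' th' t /\ c <= x t /\ c <= x' t) ->
  x s0 = x' s0 -> th s0 = th' s0 -> x s = x' s /\ th s = th' s.
Proof.
  intros Hc H Ex Eth.
  set (D := fun t => (x t - x' t) ^ 2 + (th t - th' t) ^ 2).
  set (dD := fun t => 2 * (x t - x' t) * (cos (th t) - cos (th' t))
    + 2 * (th t - th' t) * (a * (sin (th t) / x t - sin (th' t) / x' t))).
  (* With U and V the differences in x and theta, |dD| <= 2 U V + 2 |a| V (V / c + U / c^2), and 2 U
     V <= U^2 + V^2 yields this constant. *)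
  set (K := 1 + 2 * (Rabs a * / c) + Rabs a * / c ^ 2).
  assert (Ha1 : 0 <= Rabs a * / c).
  { apply Rmult_le_pos; [apply Rabs_pos | left; now apply Rinv_0_lt_compat]. }
  assert (Ha2 : 0 <= Rabs a * / c ^ 2).
  { apply Rmult_le_pos; [apply Rabs_pos | left; apply Rinv_0_lt_compat, pow_lt, Hc]. }
  assert (HD : D s = 0).
  { apply gronwall_zero with (K := K) (s0 := s0) (dD := dD).
    - intros t Ht; destruct (H t Ht) as [[_ [Dx Dt]] [[_ [Dx' Dt']] [Hx Hx']]].
      split; [|split].
      + unfold D, dD; evar_last.
        * apply (is_derive_plus (fun t => (x t - x' t) ^ 2) (fun t => (th t - th' t) ^ 2)).
          -- apply (is_derive_pow (fun t => x t - x' t) 2).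
             apply (is_derive_minus x x'); eassumption.
          -- apply (is_derive_pow (fun t => th t - th' t) 2).
             apply (is_derive_minus th th'); eassumption.
        * unfold plus, minus, opp; simpl; unfold plus; simpl; ring.
      + unfold D; generalize (pow2_ge_0 (x t - x' t)) (pow2_ge_0 (th t - th' t)); lra.
      + unfold dD, D.
        apply Rle_trans with (1 := Rabs_triang _ _).
        rewrite !Rabs_mult, (Rabs_pos_eq 2) by lra.
        rewrite <- !(pow2_abs (_ - _)).
        generalize (cos_lipschitz (th t) (th' t)) (sin_div_lipschitz c _ _ (th t) (th' t) Hc Hx Hx').
        generalize (Rabs_pos (cos (th t) - cos (th' t)))
          (Rabs_pos (sin (th t) / x t - sin (th' t) / x' t))
          (Rabs_pos (x t - x' t)) (Rabs_pos (th t - th' t)) (Rabs_pos a).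
        unfold Rdiv.
        generalize (Rabs (cos (th t) - cos (th' t)))
          (Rabs (sin (th t) * / x t - sin (th' t) * / x' t))
          (Rabs (x t - x' t)) (Rabs (th t - th' t)).
        intros C S U V HC HS HU HV HA0 HCV HSV.
        assert (Rabs a * S <= (Rabs a * / c) * V + (Rabs a * / c ^ 2) * U) by nra.
        assert (HUV : 2 * (U * V) <= U ^ 2 + V ^ 2) by (generalize (pow2_ge_0 (U - V)); nra).
        assert (U * C <= U * V) by nra.
        assert (V * (Rabs a * S) <= V * ((Rabs a * / c) * V + (Rabs a * / c ^ 2) * U)) by nra.
        assert (0 <= U ^ 2) by nra.
        unfold K; nra.
    - unfold D; rewrite Ex, Eth; ring. }
  unfold D in HD.
  generalize (pow2_ge_0 (x s - x' s)) (pow2_ge_0 (th s - th' s)); intros.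
  split; apply Rminus_diag_uniq, Rsqr_0_uniq; rewrite Rsqr_pow2; lra.
Qed.

(** * Continuation of maximal solutions and the first integral *)

Lemma weingarten_solutionP (a b : R) (g : profile) :
  weingarten_solution a b g <->
  forall s, dom g s ->
    solves a b (px g) (ptheta g) s /\ is_derive (pz g) s (sin (ptheta g s)).
Proof.
  unfold weingarten_solution, solves, kappa1, kappa2; split; intros H s Hs;
    specialize (H s Hs).
  - destruct H as [Hx [Dx [Dz [Et Ht]]]]; split; [|exact Dz].
    split; [exact Hx|]; split; [exact Dx|].
    rewrite <- Ht; now apply Derive_correct.
  - destruct H as [[Hx [Dx Dt]] Dz].
    split; [exact Hx|]; split; [exact Dx|]; split; [exact Dz|].
    split; [eexists; exact Dt | now apply is_derive_unique].
Qed.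

Lemma dom_convex (g : profile) (p q t : R) : dom g p -> dom g q -> p <= t <= q -> dom g t.
Proof.
  intros [Hp _] [_ Hq] Ht; split.
  - apply Rbar_lt_le_trans with p; simpl; tauto.
  - apply Rbar_le_lt_trans with q; simpl; tauto.
Qed.

Lemma dom_segment (g : profile) (p q t : R) :
  dom g p -> dom g q -> Rmin p q <= t <= Rmax p q -> dom g t.
Proof.
  intros Hp Hq; unfold Rmin, Rmax; destruct Rle_dec; intros Ht.
  - now apply (dom_convex g p q).
  - apply (dom_convex g q p); auto; lra.
Qed.

Lemma dom_dec (g : profile) (s : R) : {dom g s} + {~ dom g s}.
Proof.
  unfold dom; destruct (Rbar_lt_dec (lo g) s), (Rbar_lt_dec s (hi g)); tauto.
Qed.

Lemma locally_dom (g : profile) (s : R) : dom g s -> locally s (dom g).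
Proof. intros [H1 H2]; apply locally_interval with (lo g) (hi g); unfold dom; auto. Qed.

Lemma primitive_on_ball (f : R -> R) (s1 c d : R) :
  (forall t, Rabs (t - s1) < d -> continuous f t) ->
  exists F : R -> R, F s1 = c /\ forall t, Rabs (t - s1) < d -> is_derive F t (f t).
Proof.
  intros Hf; exists (fun t => c + RInt f s1 t); split.
  - rewrite RInt_point; unfold zero; simpl; ring.
  - intros t Ht.
    replace (f t) with (plus zero (f t)) by (unfold plus, zero; simpl; ring).
    apply (is_derive_plus (fun _ => c) (fun t => RInt f s1 t)).
    + apply @is_derive_const.
    + apply is_derive_RInt with s1; [|now apply Hf].
      assert (He : 0 < d - Rabs (t - s1)) by lra.
      exists (mkposreal _ He); intros u Hu; change (Rabs (u - t) < d - Rabs (t - s1)) in Hu.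
      apply (RInt_correct f), (ex_RInt_continuous f); intros r Hr; apply Hf.
      revert Hu Hr; unfold Rmin, Rmax, Rabs; destruct Rle_dec; repeat destruct Rcase_abs; lra.
Qed.

(** [m] is the smaller of the two; the last conjunct locates a point of the enlarged interval in the
    old one or in the new ball. *)
Lemma Rbar_lower (l : Rbar) (r : R) :
  exists m : Rbar, Rbar_le m l /\ Rbar_le m r /\ forall s : R, Rbar_lt m s -> Rbar_lt l s \/ r < s.
Proof.
  destruct (Rbar_le_lt_dec l r) as [H | H].
  - exists l; split; [apply Rbar_le_refl|]; auto.
  - exists r; split; [now apply Rbar_lt_le|]; split; [apply Rbar_le_refl|]; auto.
Qed.

Lemma Rbar_upper (l : Rbar) (r : R) :
  exists m : Rbar, Rbar_le l m /\ Rbar_le r m /\ forall s : R, Rbar_lt s m -> Rbar_lt s l \/ s < r.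
Proof.
  destruct (Rbar_le_lt_dec r l) as [H | H].
  - exists l; split; [apply Rbar_le_refl|]; auto.
  - exists r; split; [now apply Rbar_lt_le|]; split; [apply Rbar_le_refl|]; auto.
Qed.

(** The local solution through a point of [g] is glued to [g], giving a solution on an interval that
    contains both domains. Maximality says that this interval is no larger, so the ball already
    fits. *)
Lemma maximal_solution_ball (a b c : R) (g : profile) :
  0 < c -> maximal_solution a b g -> (forall s, dom g s -> c <= px g s) ->
  exists d, 0 < d /\ forall s1, dom g s1 -> Rbar_le (lo g) (s1 - d) /\ Rbar_le (s1 + d) (hi g).
Proof.
  intros Hc [Hsol Hmax] Hg.
  rewrite weingarten_solutionP in Hsol.
  destruct (local_solution a b c Hc) as [d [Hd Hloc]].
  exists d; split; [exact Hd|]; intros s1 Hs1.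
  destruct (Hloc s1 (px g s1) (ptheta g s1) (Hg s1 Hs1)) as [x [th [Hx1 [Hth1 Hsol']]]].
  destruct (primitive_on_ball (fun t => sin (th t)) s1 (pz g s1) d) as [z [Hz1 Hz]].
  { intros t Ht; destruct (Hsol' t Ht) as [[_ [_ Dt]] _].
    apply (continuous_comp th sin); [apply (ex_derive_continuous th); eexists; exact Dt|].
    apply continuity_pt_filterlim, continuity_sin. }
  destruct (Rbar_lower (lo g) (s1 - d)) as [l [Hl1 [Hl2 Hl3]]].
  destruct (Rbar_upper (hi g) (s1 + d)) as [r [Hr1 [Hr2 Hr3]]].
  set (glue := fun f f' : R -> R => fun s => if dom_dec g s then f s else f' s).
  set (h := Profile l r (glue (px g) x) (glue (pz g) z) (glue (ptheta g) th)).
  assert (Hdom : forall f f' s, dom g s -> glue f f' s = f s).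
  { intros f f' s Hs; unfold glue; now destruct (dom_dec g s). }
  assert (Huniq : forall s, Rabs (s - s1) < d -> dom g s ->
    px g s = x s /\ pz g s = z s /\ ptheta g s = th s).
  { intros s Hs Hs'.
    assert (Hball : forall t, Rmin s1 s <= t <= Rmax s1 s -> Rabs (t - s1) < d).
    { intros t Ht; revert Ht Hs; unfold Rmin, Rmax, Rabs; destruct Rle_dec; repeat destruct Rcase_abs; lra. }
    (* Agreement is needed on the whole segment and not only at [s], because the comparison of
       heights integrates sin theta over it. *)
    assert (Hxt : forall s', Rmin s1 s <= s' <= Rmax s1 s -> px g s' = x s' /\ ptheta g s' = th s').
    { intros s' Hs2; apply solves_unique with (a := a) (b := b) (c := c / 2) (s0 := s1); auto; [lra|].
      intros t Ht.
      assert (Ht' : Rmin s1 s <= t <= Rmax s1 s).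
      { revert Ht Hs2; unfold Rmin, Rmax; repeat destruct Rle_dec; lra. }
      assert (Dt : dom g t) by now apply (dom_segment g s1 s).
      destruct (Hsol' t (Hball t Ht')) as [S1 S2].
      split; [apply Hsol, Dt|]; split; [exact S1|]; split; [|exact S2].
      specialize (Hg t Dt); lra. }
    destruct (Hxt s) as [E1 E2]; [split; [apply Rmin_r | apply Rmax_r]|].
    split; [exact E1|]; split; [|exact E2].
    assert (E : Rabs ((pz g s - z s) - (pz g s1 - z s1)) <= 0 * Rabs (s - s1)).
    { apply (Rabs_mvt (fun t => pz g t - z t) (fun t => sin (ptheta g t) - sin (th t))).
      - intros t Ht; apply (is_derive_minus (pz g) z).
        + apply Hsol; now apply (dom_segment g s1 s).
        + now apply Hz, Hball.
      - intros t Ht; destruct (Hxt t Ht) as [_ ->]; rewrite Rminus_diag, Rabs_R0; lra. }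
    rewrite Hz1, Rmult_0_l in E; generalize (Rabs_pos (pz g s - z s - (pz g s1 - pz g s1))).
    intros E'; assert (E0 := Rle_antisym _ _ E E').
    revert E0; unfold Rabs; destruct Rcase_abs; lra. }
  assert (Hball : forall f f' s, (f = px g /\ f' = x) \/ (f = pz g /\ f' = z) \/ (f = ptheta g /\ f' = th) ->
    Rabs (s - s1) < d -> glue f f' s = f' s).
  { intros f f' s Hff Hs; unfold glue; destruct (dom_dec g s) as [Hs'|]; [|reflexivity].
    destruct (Huniq s Hs Hs') as [E1 [E2 E3]].
    destruct Hff as [[-> ->] | [[-> ->] | [-> ->]]]; assumption. }
  assert (Hext : extends g h).
  { split; [exact Hl1|]; split; [exact Hr1|]; intros s Hs; simpl; now rewrite !Hdom by exact Hs. }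
  assert (Hh : weingarten_solution a b h).
  { apply weingarten_solutionP; intros s Hs; simpl.
    destruct (dom_dec g s) as [Hs' | Hs'].
    - unfold solves; rewrite !Hdom by exact Hs'.
      destruct (Hsol s Hs') as [[S1 [S2 S3]] S4].
      assert (Dext : forall f f' k, is_derive f s k -> is_derive (glue f f') s k).
      { intros f f' k; apply is_derive_ext_loc.
        apply filter_imp with (2 := locally_dom g s Hs'); intros t Ht; symmetry; now apply Hdom. }
      split; [split; [exact S1|]; split|]; now apply Dext.
    (* A point outside the domain of [g] lies in the ball, since that domain is an interval
       containing [s1]. Around it the glued functions coincide with the local solution, even at
       nearby points of [g], by uniqueness; this covers the old end points. *)
    - assert (Hs2 : Rabs (s - s1) < d).
      { destruct Hs as [Hsl Hsr]; destruct Hs1 as [H1l H1r].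
        destruct (Hl3 s Hsl) as [Hl | Hl]; destruct (Hr3 s Hsr) as [Hr | Hr].
        - now destruct Hs'.
        - destruct (Rle_dec s s1) as [Hle | Hgt].
          + destruct Hs'; split; [exact Hl|]; apply Rbar_le_lt_trans with s1; [exact Hle | exact H1r].
          + apply Rabs_def1; lra.
        - destruct (Rle_dec s1 s) as [Hle | Hgt].
          + destruct Hs'; split; [|exact Hr]; apply Rbar_lt_le_trans with s1; [exact H1l | exact Hle].
          + apply Rabs_def1; lra.
        - apply Rabs_def1; lra. }
      unfold solves; rewrite !Hball by auto.
      destruct (Hsol' s Hs2) as [[S1 [S2 S3]] _].
      assert (He : 0 < d - Rabs (s - s1)) by lra.
      assert (Dext : forall f f' k, (f = px g /\ f' = x) \/ (f = pz g /\ f' = z) \/ (f = ptheta g /\ f' = th) ->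
        is_derive f' s k -> is_derive (glue f f') s k).
      { intros f f' k Hff; apply is_derive_ext_loc.
        exists (mkposreal _ He); intros t Ht; change (Rabs (t - s) < d - Rabs (s - s1)) in Ht.
        symmetry; apply Hball; [exact Hff|].
        replace (t - s1) with ((t - s) + (s - s1)) by ring.
        apply Rle_lt_trans with (1 := Rabs_triang _ _); lra. }
      split; [split; [exact S1|]; split|]; apply Dext; auto. }
  destruct (Hmax h Hh Hext) as [El Er]; simpl in El, Er.
  rewrite <- El, <- Er; split; assumption.
Qed.

Lemma maximal_solution_complete (a b c : R) (g : profile) (s0 : R) :
  0 < c -> dom g s0 -> maximal_solution a b g -> (forall s, dom g s -> c <= px g s) ->
  forall s, dom g s.
Proof.
  intros Hc H0 Hmax Hg.
  destruct (maximal_solution_ball a b c g Hc Hmax Hg) as [d [Hd H]].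
  unfold dom in *; destruct H0 as [H0l H0r].
  assert (El : lo g = m_infty).
  { destruct (lo g) as [l | |]; simpl in H0l; [|tauto | reflexivity]; exfalso.
    (* A point of the domain at distance at most d / 2 from a finite end, so that a step of length d
       passes the end. *)
    destruct (H (Rmin s0 (l + d / 2))) as [H1 _].
    - split; [simpl; apply Rmin_case; lra|].
      apply Rbar_le_lt_trans with s0; [apply Rmin_l | exact H0r].
    - simpl in H1; generalize (Rmin_r s0 (l + d / 2)); lra. }
  assert (Er : hi g = p_infty).
  { destruct (hi g) as [r | |]; simpl in H0r; [| reflexivity | tauto]; exfalso.
    destruct (H (Rmax s0 (r - d / 2))) as [_ H1].
    - split; [|simpl; apply Rmax_case; lra].
      rewrite El; exact I.
    - simpl in H1; generalize (Rmax_r s0 (r - d / 2)); lra. }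
  rewrite El, Er; intros s; split; exact I.
Qed.

(** The power x^(-a) is written as exp(-a ln x). The derivative of [E] is x^(-a) cos theta (b - (1 -
    a) be), the terms in sin theta / x cancelling, so [be = b / (1 - a)] is exactly the value that
    makes it vanish. *)
Lemma first_integral (a b : R) (g : profile) (p q : R) :
  a < 0 -> weingarten_solution a b g -> dom g p -> dom g q ->
  let E := fun s => exp (- a * ln (px g s)) * (sin (ptheta g s) - b / (1 - a) * px g s) in
  E q = E p.
Proof.
  intros Ha Hsol Hp Hq E; rewrite weingarten_solutionP in Hsol.
  assert (H : Rabs (E q - E p) <= 0 * Rabs (q - p)).
  { apply (Rabs_mvt E (fun _ => 0)).
    - intros t Ht; destruct (Hsol t (dom_segment g p q t Hp Hq Ht)) as [[S1 [S2 S3]] _].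
      unfold E; auto_derive.
      + repeat split; auto; eexists; eassumption.
      + replace (Derive (fun x : R => px g x) t) with (cos (ptheta g t))
          by now symmetry; apply is_derive_unique.
        replace (Derive (fun x : R => ptheta g x) t) with (a * (sin (ptheta g t) / px g t) + b)
          by now symmetry; apply is_derive_unique.
        field; lra.
    - intros; rewrite Rabs_R0; lra. }
  rewrite Rmult_0_l in H; generalize (Rabs_pos (E q - E p)); intros H'.
  apply Rminus_diag_uniq; revert H H'; unfold Rabs; destruct Rcase_abs; lra.
Qed.

Lemma first_integral_sign (a b : R) (g : profile) (p q : R) :
  a < 0 -> weingarten_solution a b g -> dom g p -> dom g q ->
  let k := fun s => sin (ptheta g s) - b / (1 - a) * px g s in
  (k p = 0 -> k q = 0) /\ (0 < k p -> 0 < k q) /\ (k p < 0 -> k q < 0).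
Proof.
  intros Ha Hsol Hp Hq k; generalize (first_integral a b g p q Ha Hsol Hp Hq); simpl.
  fold (k p) (k q).
  generalize (exp_pos (- a * ln (px g p))) (exp_pos (- a * ln (px g q))).
  generalize (exp (- a * ln (px g p))) (exp (- a * ln (px g q))); intros u v Hu Hv E.
  repeat split; intros; nra.
Qed.

Lemma px_lower_bound (a b : R) (g : profile) (s0 : R) :
  a < 0 -> 0 < b -> weingarten_solution a b g -> dom g s0 ->
  sin (ptheta g s0) - b / (1 - a) * px g s0 <> 0 ->
  exists c, 0 < c /\ forall s, dom g s -> c <= px g s.
Proof.
  intros Ha Hb Hsol H0 HE.
  set (E := exp (- a * ln (px g s0)) * (sin (ptheta g s0) - b / (1 - a) * px g s0)).
  set (be := b / (1 - a)) in *; assert (Hbe : 0 < be) by (apply Rdiv_lt_0_compat; lra).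
  assert (HE' : 0 < Rabs E).
  { apply Rabs_pos_lt, Rmult_integral_contrapositive_currified; [apply Rgt_not_eq, exp_pos | exact HE]. }
  (* For x < 1 the second factor is at most 1 + be in absolute value, so x^(-a) >= k; the threshold
     exp(ln k / -a) solves x^(-a) = k. *)
  set (k := Rabs E / (1 + be)); assert (Hk : 0 < k) by (apply Rdiv_lt_0_compat; lra).
  exists (Rmin 1 (exp (ln k / - a))); split; [apply Rmin_case; [lra | apply exp_pos]|].
  intros s Hs; apply Rnot_lt_le; intros Hlt.
  assert (Hx : 0 < px g s) by (rewrite weingarten_solutionP in Hsol; apply Hsol, Hs).
  assert (Hx1 : px g s < 1) by (apply Rlt_le_trans with (1 := Hlt), Rmin_l).
  assert (Hx2 : px g s < exp (ln k / - a)) by (apply Rlt_le_trans with (1 := Hlt), Rmin_r).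
  apply ln_increasing in Hx2; [|exact Hx]; rewrite ln_exp in Hx2.
  assert (Hx3 : exp (- a * ln (px g s)) < k).
  { rewrite <- (exp_ln k Hk); apply exp_increasing.
    replace (ln k) with (- a * (ln k / - a)) by (field; lra).
    apply Rmult_lt_compat_l; lra. }
  assert (EE : Rabs E = exp (- a * ln (px g s)) * Rabs (sin (ptheta g s) - be * px g s)).
  { unfold E; generalize (first_integral a b g s0 s Ha Hsol H0 Hs); simpl; fold be; intros <-.
    rewrite Rabs_mult, Rabs_pos_eq; [reflexivity | left; apply exp_pos]. }
  assert (Hb1 : Rabs (sin (ptheta g s) - be * px g s) <= 1 + be).
  { generalize (SIN_bound (ptheta g s)); intros; apply Rabs_le; nra. }
  assert (Hkk : Rabs E = k * (1 + be)) by (unfold k; field; lra).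
  generalize (Rabs_pos (sin (ptheta g s) - be * px g s)) (exp_pos (- a * ln (px g s))); nra.
Qed.

(** * Symmetry, period and loops of complete solutions *)

Definition complete_solution (a b c : R) (x z th : R -> R) : Prop :=
  0 < c /\
  forall s, solves a b x th s /\ is_derive z s (sin (th s)) /\ c <= x s.

Lemma ex_derive_continuity (f : R -> R) : (forall s, ex_derive f s) -> continuity f.
Proof. intros H s; apply continuity_pt_filterlim, (ex_derive_continuous f), H. Qed.

Lemma is_derive_reflect (f : R -> R) (l r s : R) :
  is_derive f (r - s) l -> is_derive (fun s => f (r - s)) s (- l).
Proof.
  intros Hf; evar_last.
  - apply (is_derive_comp f (fun s => r - s)); [exact Hf|].
    apply (is_derive_minus (fun _ => r) (fun s => s)); [apply @is_derive_const | apply @is_derive_id].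
  - unfold scal, minus, plus, opp, one, zero; simpl; unfold mult; simpl; ring.
Qed.

Lemma is_derive_sub_reflect (f : R -> R) (l c r s : R) :
  is_derive f (r - s) l -> is_derive (fun s => c - f (r - s)) s l.
Proof.
  intros Hf; evar_last.
  - apply (is_derive_minus (fun _ => c)); [apply @is_derive_const | apply is_derive_reflect, Hf].
  - unfold minus, plus, opp, zero; simpl; ring.
Qed.

Lemma is_derive_sin_comp (th : R -> R) (s l : R) :
  is_derive th s l -> is_derive (fun s => sin (th s)) s (cos (th s) * l).
Proof.
  intros H; evar_last.
  - apply (is_derive_comp sin th); [apply is_derive_Reals, derivable_pt_lim_sin | exact H].
  - apply Rmult_comm.
Qed.

Lemma is_derive_cos_comp (th : R -> R) (s l : R) :
  is_derive th s l -> is_derive (fun s => cos (th s)) s (- sin (th s) * l).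
Proof.
  intros H; evar_last.
  - apply (is_derive_comp cos th); [apply is_derive_Reals, derivable_pt_lim_cos | exact H].
  - apply Rmult_comm.
Qed.

Lemma sin_reflect (t0 t : R) : cos t0 = 0 -> sin (2 * t0 - t) = sin t.
Proof.
  intros H; rewrite sin_minus, sin_2a, cos_2a_sin; generalize (sin2_cos2 t0); unfold Rsqr; rewrite H.
  intros E; replace (2 * sin t0 * sin t0) with 2 by lra; ring.
Qed.

Lemma cos_reflect (t0 t : R) : cos t0 = 0 -> cos (2 * t0 - t) = - cos t.
Proof.
  intros H; rewrite cos_minus, sin_2a, cos_2a_sin; generalize (sin2_cos2 t0); unfold Rsqr; rewrite H.
  intros E; replace (2 * sin t0 * sin t0) with 2 by lra; ring.
Qed.

Section Complete.

Variables (a b c : R) (x z th : R -> R).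
Hypothesis Hsol : complete_solution a b c x z th.

(** Since cos theta vanishes at [s1], the substitution 2 theta(s1) - theta keeps the sine and
    reverses the cosine. The reflected pair therefore solves the same system, with the same values
    at [s1], and uniqueness applies. *)
Lemma complete_reflect (s1 s : R) :
  cos (th s1) = 0 -> x (2 * s1 - s) = x s /\ th (2 * s1 - s) = 2 * th s1 - th s.
Proof.
  destruct Hsol as [Hc H]; intros H1.
  destruct (solves_unique a b c s1 s (fun s => x (2 * s1 - s))
    (fun s => 2 * th s1 - th (2 * s1 - s)) x th Hc) as [Ex Et].
  - intros t _.
    destruct (H t) as [S1 [_ S3]]; destruct (H (2 * s1 - t)) as [[R0 [R1 R2]] [_ R3]].
    split; [|split; [exact S1 | split; [exact R3 | exact S3]]].
    unfold solves; rewrite sin_reflect, cos_reflect by exact H1.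
    split; [exact R0|]; split.
    + now apply is_derive_reflect.
    + now apply is_derive_sub_reflect.
  - f_equal; ring.
  - replace (2 * s1 - s1) with s1 by ring; ring.
  - rewrite Ex, <- Et; split; [reflexivity | ring].
Qed.

Lemma complete_reflect_z (s1 s : R) : cos (th s1) = 0 -> z (2 * s1 - s) = 2 * z s1 - z s.
Proof.
  intros H1; destruct Hsol as [_ H].
  assert (E : Rabs ((2 * z s1 - z (2 * s1 - s) - z s) - (2 * z s1 - z (2 * s1 - s1) - z s1)) <= 0 * Rabs (s - s1)).
  { apply (Rabs_mvt (fun s => 2 * z s1 - z (2 * s1 - s) - z s) (fun t => sin (th (2 * s1 - t)) - sin (th t))).
    - intros t _; apply (is_derive_minus (fun s => 2 * z s1 - z (2 * s1 - s)) z); [|apply H].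
      apply is_derive_sub_reflect, H.
    - intros t _; destruct (complete_reflect s1 t H1) as [_ ->].
      rewrite sin_reflect, Rminus_diag, Rabs_R0 by exact H1; lra. }
  replace (2 * s1 - s1) with s1 in E by ring; rewrite Rmult_0_l in E.
  revert E; unfold Rabs; destruct Rcase_abs; lra.
Qed.

Lemma z_cos_increasing (s1 s2 : R) :
  a < 0 -> b <> 0 -> s1 < s2 -> b * z s1 + cos (th s1) < b * z s2 + cos (th s2).
Proof.
  intros Ha Hb Hs; destruct Hsol as [_ H].
  set (W := fun s => b * z s + cos (th s)).
  set (dW := fun s => - a * (sin (th s)) ^ 2 / x s).
  assert (HdW : forall s, is_derive W s (dW s)).
  { intros s; destruct (H s) as [[S0 [_ S2]] [S3 _]]; unfold W, dW; evar_last.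
    - apply (is_derive_plus (fun s => b * z s) (fun s => cos (th s))).
      + apply is_derive_scal, S3.
      + apply is_derive_cos_comp, S2.
    - unfold plus; simpl; field; lra. }
  assert (HdW0 : forall s, 0 <= dW s).
  { intros s; unfold dW; apply Rdiv_le_0_compat; [|apply H].
    generalize (pow2_ge_0 (sin (th s))); nra. }
  assert (Hmono : forall p q, p <= q -> W p <= W q).
  { intros p q Hpq; apply derive_nonneg_incr with dW; auto. }
  (* Strictness: sin theta cannot vanish throughout an interval. If it vanishes at [p] and [q],
     Rolle gives a point where cos theta theta' = 0; were sin theta zero there too, then theta' = b
     there, forcing cos theta = 0 as well. *)
  assert (Ht0 : exists t0, s1 < t0 < s2 /\ sin (th t0) <> 0).
  { set (p := (2 * s1 + s2) / 3); set (q := (s1 + 2 * s2) / 3).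
    destruct (Req_dec (sin (th p)) 0) as [Hp | Hp]; [|exists p; split; [unfold p; lra | exact Hp]].
    destruct (Req_dec (sin (th q)) 0) as [Hq | Hq]; [|exists q; split; [unfold q; lra | exact Hq]].
    destruct (is_derive_mvt (fun s => sin (th s)) (fun s => cos (th s) * (a * (sin (th s) / x s) + b)) p q)
      as [r [Hr E]].
    - unfold p, q; lra.
    - intros t _; apply is_derive_sin_comp, H.
    - exists r; split; [unfold p, q in Hr; lra|]; intros Hr0.
      rewrite Hp, Hq, Hr0 in E; unfold Rdiv in E; rewrite Rmult_0_l, Rmult_0_r, Rplus_0_l in E.
      generalize (sin2_cos2 (th r)); unfold Rsqr; rewrite Hr0; intros Hcos.
      assert (Hqp : 0 < q - p) by (unfold p, q; lra).
      assert (Hz : cos (th r) * b * (q - p) = 0) by lra.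
      apply Rmult_integral in Hz as [Hz | Hz]; [|lra].
      apply Rmult_integral in Hz as [Hz | Hz]; [|lra].
      rewrite Hz in Hcos; lra. }
  destruct Ht0 as [t0 [Ht0 Hsin]].
  apply Rnot_le_lt; intros Hle; change (W s2 <= W s1) in Hle.
  assert (Hd0 : is_derive W t0 0).
  { apply is_derive_ext_loc with (fun _ => W s1); [|apply @is_derive_const].
    apply locally_interval with s1 s2; simpl; try lra; intros y Hy1 Hy2.
    assert (W s1 <= W y) by (apply Hmono; lra); assert (W y <= W s2) by (apply Hmono; lra); lra. }
  assert (E : dW t0 = 0).
  { rewrite <- (is_derive_unique _ _ _ (HdW t0)); now apply is_derive_unique. }
  assert (Hpos : 0 < dW t0); [|lra].
  unfold dW; apply Rdiv_lt_0_compat; [|apply H].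
  generalize (pow2_gt_0 _ Hsin); nra.
Qed.

(** The composition of the reflections about the two points is a translation of the parameter. At
    both points [b * z + cos th] reduces to [b * z], so strict growth makes the shift in z
    nonzero. *)
Lemma complete_periodic (s1 s2 : R) :
  a < 0 -> b <> 0 -> s1 < s2 -> cos (th s1) = 0 -> cos (th s2) = 0 ->
  exists L T, 0 < L /\ T <> 0 /\ forall s, x (s + L) = x s /\ z (s + L) = z s + T.
Proof.
  intros Ha Hb Hs H1 H2; exists (2 * (s2 - s1)), (2 * (z s2 - z s1)).
  split; [lra|]; split.
  - generalize (z_cos_increasing s1 s2 Ha Hb Hs); rewrite H1, H2; nra.
  - intros s; replace (s + 2 * (s2 - s1)) with (2 * s2 - (2 * s1 - s)) by ring.
    destruct (complete_reflect s2 (2 * s1 - s) H2) as [-> _].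
    destruct (complete_reflect s1 s H1) as [-> _].
    rewrite (complete_reflect_z s2 _ H2), (complete_reflect_z s1 s H1); split; ring.
Qed.

Lemma continuity_th : continuity th.
Proof. apply ex_derive_continuity; intros s; eexists; apply Hsol. Qed.

Lemma continuity_cos_th : continuity (fun s => cos (th s)).
Proof. apply ex_derive_continuity; intros s; eexists; apply is_derive_cos_comp, Hsol. Qed.

(* While [cos th] keeps the sign [sg], the turning rate times [sg] increases. If it becomes
   positive, [sg * cos th] drops below 0 in finite time; otherwise [sg * x] grows linearly. *)
Lemma cos_sign_not_eventual (sg S : R) :
  a < 0 -> 0 < b -> (forall s, b / (1 - a) * x s < sin (th s)) -> sg = 1 \/ sg = -1 ->
  ~ (forall s, S <= s -> 0 < sg * cos (th s)).
Proof.
  intros Ha Hb Hk Hsg HC; destruct Hsol as [Hc H].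
  set (be := b / (1 - a)) in *; assert (Hbe : 0 < be) by (apply Rdiv_lt_0_compat; lra).
  set (r := fun s => a * (sin (th s) / x s) + b).
  set (dr := fun s => a * ((cos (th s) * r s * x s - sin (th s) * cos (th s)) / x s ^ 2)).
  assert (Hdr : forall s, is_derive (fun s => sg * r s) s (sg * dr s)).
  { intros s; destruct (H s) as [[S0 [S1 S2]] _].
    apply is_derive_scal; unfold r at 1, dr; evar_last.
    - apply (is_derive_plus (fun s => a * (sin (th s) / x s)) (fun _ => b)); [|apply @is_derive_const].
      apply is_derive_scal, (is_derive_div (fun s => sin (th s)) x); [|exact S1 | lra].
      apply is_derive_sin_comp, S2.
    - unfold plus, zero; simpl; unfold r; field; lra. }
  assert (Hdr0 : forall s, S <= s -> 0 <= sg * dr s).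
  { intros s Hs; destruct (H s) as [[S0 _] _].
    (* From b = (1 - a) be follows r x - sin theta = -(1 - a) (sin theta - be x), which fixes the
       sign of the derivative of the turning rate. *)
    replace (sg * dr s) with (- a * (sg * cos (th s)) * ((1 - a) * (sin (th s) - be * x s) / x s ^ 2)).
    - apply Rmult_le_pos; [apply Rmult_le_pos; [lra | left; now apply HC]|].
      apply Rdiv_le_0_compat; [|now apply pow_lt].
      specialize (Hk s); nra.
    - unfold dr, r, be; field; lra. }
  assert (HdC : forall s, is_derive (fun s => sg * cos (th s)) s (sg * (- sin (th s) * r s))).
  { intros s; apply is_derive_scal, is_derive_cos_comp, H. }
  assert (Hsin : forall s, be * c <= sin (th s)).
  { intros s; specialize (Hk s); destruct (H s) as [_ [_ Hx]]; nra. }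
  assert (Hbec : 0 < be * c) by now apply Rmult_lt_0_compat.
  assert (Hsgc : forall s, -1 <= sg * cos (th s) <= 1).
  { intros s; generalize (COS_bound (th s)); destruct Hsg as [-> | ->]; lra. }
  destruct (classic (exists s1, S <= s1 /\ 0 < sg * r s1)) as [[s1 [Hs1 Hr1]] | Hno].
  - assert (Hr : forall s, s1 <= s -> sg * r s1 <= sg * r s).
    { intros s Hs; apply derive_nonneg_incr with (f := fun s => sg * r s) (df := fun s => sg * dr s); auto.
      intros t Ht; apply Hdr0; lra. }
    set (rho := be * c * (sg * r s1)); assert (Hrho : 0 < rho) by now apply Rmult_lt_0_compat.
    (* Starting from at most 1 and falling at rate at least [rho], [sg * cos th] would be at most -1
       after a length 2 / rho. *)
    set (s2 := s1 + 2 / rho).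
    assert (Hs2 : s1 < s2) by (unfold s2; assert (0 < 2 / rho) by (apply Rdiv_lt_0_compat; lra); lra).
    destruct (is_derive_mvt (fun s => sg * cos (th s)) (fun s => sg * (- sin (th s) * r s)) s1 s2 Hs2)
      as [t [Ht E]]; [intros; apply HdC|].
    assert (Hneg : sg * (- sin (th t) * r t) <= - rho).
    { specialize (Hr t ltac:(lra)); specialize (Hsin t); unfold rho; nra. }
    assert (Hlen : rho * (s2 - s1) = 2) by (unfold s2; field; lra).
    specialize (HC s2 ltac:(lra)); destruct (Hsgc s1); nra.
  - assert (HCS : forall s, S <= s -> sg * cos (th S) <= sg * cos (th s)).
    { intros s Hs; apply derive_nonneg_incr with (f := fun s => sg * cos (th s)) (df := fun s => sg * (- sin (th s) * r s)); auto.
      intros t Ht.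
      assert (Hrt : sg * r t <= 0) by (apply Rnot_lt_le; intros Hlt; apply Hno; exists t; split; [lra | exact Hlt]).
      specialize (Hsin t); nra. }
    assert (HCS0 : 0 < sg * cos (th S)) by (apply HC; lra).
    set (k := be * (sg * cos (th S))); assert (Hk0 : 0 < k) by now apply Rmult_lt_0_compat.
    (* Over this length be times [sg * x] would grow by at least 3, but be x stays between 0 and 1
       because be x < sin theta <= 1. *)
    set (s2 := S + 3 / k).
    assert (Hs2 : S < s2) by (unfold s2; assert (0 < 3 / k) by (apply Rdiv_lt_0_compat; lra); lra).
    destruct (is_derive_mvt (fun s => sg * x s) (fun s => sg * cos (th s)) S s2 Hs2)
      as [t [Ht E]]; [intros; apply is_derive_scal, H|].
    assert (Hlen : k * (s2 - S) = 3) by (unfold s2; field; lra).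
    specialize (HCS t ltac:(lra)).
    assert (Hx : forall s, 0 < be * x s < 1).
    { intros s; specialize (Hk s); destruct (H s) as [[S0 _] _].
      generalize (SIN_bound (th s)); split; [nra | lra]. }
    destruct (Hx S), (Hx s2).
    assert (E3 : 3 <= be * (sg * x s2 - sg * x S)).
    { rewrite E, <- Hlen; unfold k; rewrite !Rmult_assoc; apply Rmult_le_compat_l; [lra|].
      rewrite <- !Rmult_assoc; apply Rmult_le_compat_r; lra. }
    destruct Hsg as [-> | ->]; nra.
Qed.

Lemma cos_vanishes_after (S : R) :
  a < 0 -> 0 < b -> (forall s, b / (1 - a) * x s < sin (th s)) ->
  exists s, S <= s /\ cos (th s) = 0.
Proof.
  intros Ha Hb Hk.
  apply NNPP; intros Hno.
  assert (Hno' : forall s, S <= s -> cos (th s) <> 0) by (intros s Hs H0; apply Hno; now exists s).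
  assert (Hsg : exists sg, (sg = 1 \/ sg = -1) /\ 0 < sg * cos (th S)).
  { specialize (Hno' S ltac:(lra)).
    destruct (Rlt_dec 0 (cos (th S))); [exists 1 | exists (-1)]; split; auto; lra. }
  destruct Hsg as [sg [Hsg HS]].
  apply (cos_sign_not_eventual sg S Ha Hb Hk Hsg); intros s Hs.
  apply Rnot_le_lt; intros Hle.
  destruct (IVT_gen (fun s => cos (th s)) S s 0 continuity_cos_th) as [t [Ht E]].
  - unfold Rmin, Rmax; destruct Rle_dec; destruct Hsg as [-> | ->]; lra.
  - rewrite Rmin_left in Ht by exact Hs; apply (Hno' t); [lra | exact E].
Qed.

(** [k] bounds the turning rate from below, so theta moves by at least k d on either side of 0;
    taking k d to be the distance from [th 0] to [y] suffices. *)
Lemma th_onto (k y : R) :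
  0 < k -> (forall s, k <= a * (sin (th s) / x s) + b) -> exists s, th s = y.
Proof.
  intros Hk Hth; destruct Hsol as [_ H].
  assert (Hgrow : forall p q, p <= q -> k * (q - p) <= th q - th p).
  { intros p q [Hpq | ->]; [|lra].
    destruct (is_derive_mvt th (fun s => a * (sin (th s) / x s) + b) p q Hpq) as [r [_ ->]].
    - intros; apply H.
    - apply Rmult_le_compat_r; [lra | apply Hth]. }
  set (d := Rabs (y - th 0) / k).
  assert (Hd : k * d = Rabs (y - th 0)) by (unfold d; field; lra).
  assert (Hd0 : 0 <= d) by (apply Rdiv_le_0_compat; [apply Rabs_pos | exact Hk]).
  destruct (IVT_gen th (- d) d y continuity_th) as [s [_ Hs]].
  - generalize (Hgrow (- d) 0 ltac:(lra)) (Hgrow 0 d ltac:(lra)); intros.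
    assert (th (- d) <= y <= th d) by (revert Hd; unfold Rabs; destruct Rcase_abs; intros; nra).
    unfold Rmin, Rmax; destruct Rle_dec; lra.
  - now exists s.
Qed.

(** Between [s3] and [s4] x increases, while z first falls (theta < 0) and then rises past its
    initial value, returning to [z s3] at some [u]. The arc from [s3] to [u] and its mirror image
    about [s3] close up at [u], where x is largest. *)
Lemma complete_loop (s3 s4 : R) :
  a < 0 -> 0 < b -> (forall s, 0 < a * (sin (th s) / x s) + b) ->
  th s3 = - (PI / 2) -> th s4 = PI / 2 ->
  exists s1 s2, s1 < s2 /\ x s1 = x s2 /\ z s1 = z s2 /\
    (forall s t, s1 <= s -> s < t -> t <= s2 -> x s = x t -> z s = z t -> s = s1 /\ t = s2) /\
    (forall s, s1 < s < s2 -> x s < x s1).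
Proof.
  intros Ha Hb Hth H3 H4; destruct Hsol as [_ H]; assert (HPI := PI_RGT_0).
  assert (Hinc : forall p q, p < q -> th p < th q).
  { intros p q Hpq; apply derive_pos_incr with (fun s => a * (sin (th s) / x s) + b); auto.
    intros; apply H. }
  assert (Hrefl : forall t, x (s3 - t) = x (s3 + t) /\ z (s3 - t) = 2 * z s3 - z (s3 + t)).
  { assert (C3 : cos (th s3) = 0) by now rewrite H3, cos_neg, cos_PI2.
    intros t; replace (s3 - t) with (2 * s3 - (s3 + t)) by ring.
    split; [now apply complete_reflect | now apply complete_reflect_z]. }
  assert (H34 : s3 < s4).
  { apply Rnot_le_lt; intros [Hlt | E]; [specialize (Hinc _ _ Hlt) | subst s4]; lra. }
  assert (Hxinc : forall p q, s3 <= p -> p < q -> q <= s4 -> x p < x q).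
  { intros p q Hp Hpq Hq; apply derive_pos_incr with (fun s => cos (th s)); auto.
    - intros; apply H.
    - intros t Ht; apply cos_gt_0; [rewrite <- H3 | rewrite <- H4]; apply Hinc; lra. }
  (* Both cosines vanish, so the growth of b z + cos theta is growth of z. This is what brings the
     arc back up to height [z s3] before theta passes pi/2. *)
  assert (Hz4 : z s3 < z s4).
  { generalize (z_cos_increasing s3 s4 Ha ltac:(lra) H34); rewrite H3, H4, cos_neg, cos_PI2; nra. }
  destruct (IVT_gen th s3 s4 0 continuity_th) as [m [Hm Em]].
  { rewrite H3, H4, Rmin_left, Rmax_right; lra. }
  rewrite Rmin_left, Rmax_right in Hm by lra.
  assert (Hm3 : s3 < m) by (destruct Hm as [[Hm | E] _]; [exact Hm | subst m; lra]).
  assert (Hzm : z m < z s3).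
  { apply Ropp_lt_cancel; apply derive_pos_incr with (f := fun s => - z s) (df := fun s => - sin (th s)); auto.
    - intros; apply (is_derive_opp z), H.
    - intros t Ht; rewrite <- sin_neg; apply sin_gt_0.
      + generalize (Hinc t m ltac:(lra)); lra.
      + generalize (Hinc s3 t ltac:(lra)); lra. }
  destruct (IVT_gen z m s4 (z s3)) as [u [Hu Eu]].
  { apply ex_derive_continuity; intros; eexists; apply H. }
  { rewrite Rmin_left, Rmax_right; lra. }
  rewrite Rmin_left, Rmax_right in Hu by lra.
  assert (Hmu : m < u) by (destruct Hu as [[Hu | E] _]; [exact Hu | subst u; lra]).
  (* An earlier return would give two Rolle points, hence two zeros of the strictly increasing
     angle. *)
  assert (Hfirst : forall t, s3 < t -> t < u -> z t <> z s3).
  { intros t Ht3 Htu Et.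
    destruct (is_derive_mvt z (fun s => sin (th s)) s3 t Ht3) as [r1 [Hr1 E1]]; [intros; apply H|].
    destruct (is_derive_mvt z (fun s => sin (th s)) t u Htu) as [r2 [Hr2 E2]]; [intros; apply H|].
    assert (Hzero : forall r, s3 < r < s4 -> sin (th r) = 0 -> th r = 0).
    { intros r Hr Er.
      generalize (Hinc s3 r ltac:(lra)) (Hinc r s4 ltac:(lra)); intros.
      destruct (Rtotal_order (th r) 0) as [Hn | [E0 | Hp]]; [|exact E0|].
      - generalize (sin_lt_0_var (th r) ltac:(lra) Hn); lra.
      - generalize (sin_gt_0 (th r) Hp ltac:(lra)); lra. }
    assert (Er1 : th r1 = 0) by (apply Hzero; [lra | nra]).
    assert (Er2 : th r2 = 0) by (apply Hzero; [lra | nra]).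
    generalize (Hinc r1 r2 ltac:(lra)); lra. }
  set (l := u - s3).
  assert (Hl : s3 + l = u) by (unfold l; ring).
  assert (Hxabs : forall s, s3 - l <= s <= s3 + l -> x s = x (s3 + Rabs (s - s3))).
  { intros s Hs; unfold Rabs; destruct Rcase_abs.
    - destruct (Hrefl (- (s - s3))) as [<- _]; f_equal; ring.
    - f_equal; ring. }
  exists (s3 - l), (s3 + l).
  destruct (Hrefl l) as [Ex Ez].
  split; [lra|]; split; [exact Ex|]; split; [rewrite Ez, Hl, Eu; ring|]; split.
  - intros s t Hs Hst Ht Exst Ezst.
    rewrite (Hxabs s ltac:(lra)), (Hxabs t ltac:(lra)) in Exst.
    assert (Eabs : Rabs (s - s3) = Rabs (t - s3)).
    { assert (Hb' : forall v, s3 - l <= v <= s3 + l -> 0 <= Rabs (v - s3) <= l)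
        by (intros v Hv; unfold Rabs; destruct Rcase_abs; lra).
      generalize (Hb' s ltac:(lra)) (Hb' t ltac:(lra)); intros.
      destruct (Rtotal_order (Rabs (s - s3)) (Rabs (t - s3))) as [Hlt | [E | Hlt]]; [|exact E|].
      - generalize (Hxinc (s3 + Rabs (s - s3)) (s3 + Rabs (t - s3)) ltac:(lra) ltac:(lra) ltac:(lra)); lra.
      - generalize (Hxinc (s3 + Rabs (t - s3)) (s3 + Rabs (s - s3)) ltac:(lra) ltac:(lra) ltac:(lra)); lra. }
    assert (Est : s = s3 - (t - s3) /\ s3 < t).
    { revert Eabs; unfold Rabs; repeat destruct Rcase_abs; intros; lra. }
    destruct Est as [Est Ht3].
    (* Here [s] and [t] are mirror images, so equal heights mean [z t = z s3], which does not happen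
       strictly between [s3] and [u]. *)
    assert (Etu : t = u).
    { apply NNPP; intros Hne; apply (Hfirst t Ht3); [lra|].
      destruct (Hrefl (t - s3)) as [_ E]; rewrite <- Est in E.
      replace (s3 + (t - s3)) with t in E by ring; lra. }
    unfold l; lra.
  - intros s Hs; rewrite Ex, Hxabs by lra; apply Hxinc.
    + generalize (Rabs_pos (s - s3)); lra.
    + unfold Rabs; destruct Rcase_abs; lra.
    + lra.
Qed.

End Complete.

(** * Types of surfaces for b > 0 *)

(** Both sources of surface points have to be excluded: points of the arc, and limit points added on
    the axis. *)
Lemma misses_axis_of_lower_bound (g : profile) (c : R) :
  0 < c -> (forall s, dom g s) -> (forall s, c <= px g s) -> misses_axis g.
Proof.
  intros Hc Hdom Hx u v w [q [o [Hq [Ho E]]]] [-> ->].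
  injection E as E1 E2 _.
  destruct Hq as [[s [_ ->]] | [c0 [Hlim _]]].
  - unfold S1 in Ho; simpl in E1, E2; specialize (Hx s).
    symmetry in E1, E2.
    apply Rmult_integral in E1 as [E1 | E1]; [lra|].
    apply Rmult_integral in E2 as [E2 | E2]; [lra|].
    rewrite E1, E2 in Ho; lra.
  - assert (Hno : forall e, ~ tends_to_axis g e c0).
    { intros e [H _].
      assert (Hball : locally 0 (fun y : R => Rabs (y - 0) < c)).
      { exists (mkposreal c Hc); intros y Hy; exact Hy. }
      specialize (H _ Hball).
      assert (HP : Rbar_locally' e (fun s => Rabs (px g s - 0) < c)).
      { revert H; unfold filtermap, within; apply filter_imp; intros s Hs; apply Hs, Hdom. }
      destruct (filter_ex _ HP) as [s Hs].
      apply Rabs_def2 in Hs; specialize (Hx s); lra. }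
    destruct Hlim as [Hlim | Hlim]; now apply Hno in Hlim.
Qed.

Lemma axially_periodic_of_profile (g : profile) (L T : R) :
  (forall s, dom g s) -> 0 < L -> T <> 0 ->
  (forall s, px g (s + L) = px g s /\ pz g (s + L) = pz g s + T) -> axially_periodic g.
Proof.
  intros Hdom HL HT H; exists L, T; split; [exact HL|]; split; [exact HT|].
  intros s _; split; [apply Hdom|]; split; [apply Hdom|]; intros w _.
  unfold immersion; simpl; destruct (H s) as [-> ->]; reflexivity.
Qed.

Lemma embedded_of_expanding_height (g : profile) (c k : R) :
  0 < c -> 0 < k -> (forall s, c <= px g s) ->
  (forall s s', k * Rabs (s' - s) <= Rabs (pz g s' - pz g s)) ->
  (forall s s', Rabs (px g s' - px g s) <= Rabs (s' - s)) ->
  embedded g.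
Proof.
  intros Hc Hk Hx Hz Hlip; split.
  - intros [s [o1 o2]] [s' [o1' o2']] _ _; unfold immersion; simpl; intros E.
    injection E as E1 E2 E3.
    specialize (Hz s s'); rewrite E3, Rminus_diag, Rabs_R0 in Hz.
    assert (Es : s' = s).
    { generalize (Rabs_pos (s' - s)); intros.
      assert (H0 : Rabs (s' - s) = 0) by nra.
      revert H0; unfold Rabs; destruct Rcase_abs; lra. }
    subst s'; specialize (Hx s).
    apply Rmult_eq_reg_l in E1; [|lra]; apply Rmult_eq_reg_l in E2; [|lra]; now subst.
  - intros [s [o1 o2]] [_ Ho] eps.
    (* Heights control s up to a factor 1/k. A direction then differs by at most (d + |s' - s|) / c,
       so both d / k and (1 + k) d / (c k) must stay below eps. *)
    assert (Hd : 0 < eps * (c * k / ((1 + k) * (1 + c)))).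
    { apply Rmult_lt_0_compat; [apply cond_pos|]; apply Rdiv_lt_0_compat; nra. }
    set (d := eps * (c * k / ((1 + k) * (1 + c)))) in *.
    exists (mkposreal d Hd); intros [s' [o1' o2']] [_ Ho'] [[B1 B2] B3].
    unfold immersion, S1 in *; simpl in *.
    change (Rabs (px g s' * o1' - px g s * o1) < d) in B1.
    change (Rabs (px g s' * o2' - px g s * o2) < d) in B2.
    change (Rabs (pz g s' - pz g s) < d) in B3.
    assert (Hs : k * Rabs (s' - s) < d) by (apply Rle_lt_trans with (1 := Hz s s'), B3).
    assert (Hdeps : d * ((1 + k) * (1 + c)) = c * k * eps) by (unfold d; field; lra).
    assert (Heps := cond_pos eps).
    assert (Hdck : 0 < d * c /\ 0 < d * k /\ 0 < d * c * k).
    { assert (0 < d * c) by now apply Rmult_lt_0_compat.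
      assert (0 < d * k) by now apply Rmult_lt_0_compat.
      split; [|split]; auto; now apply Rmult_lt_0_compat. }
    assert (Hw : forall o o', -1 <= o' <= 1 -> Rabs (px g s' * o' - px g s * o) < d -> Rabs (o' - o) < eps).
    { intros o o' Ho1 HB.
      assert (H1 : px g s * Rabs (o' - o) <= d + Rabs (s' - s)).
      { rewrite <- (Rabs_pos_eq (px g s)) by (specialize (Hx s); lra); rewrite <- Rabs_mult.
        replace (px g s * (o' - o)) with ((px g s' * o' - px g s * o) + - ((px g s' - px g s) * o')) by ring.
        apply Rle_trans with (1 := Rabs_triang _ _).
        rewrite Rabs_Ropp, Rabs_mult.
        assert (Rabs o' <= 1) by now apply Rabs_le.
        specialize (Hlip s s'); generalize (Rabs_pos o') (Rabs_pos (px g s' - px g s)); nra. }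
      assert (H2 : c * Rabs (o' - o) <= px g s * Rabs (o' - o))
        by (apply Rmult_le_compat_r; [apply Rabs_pos | apply Hx]).
      assert (H3 : k * (c * Rabs (o' - o)) < (1 + k) * d).
      { apply Rle_lt_trans with (k * (d + Rabs (s' - s))); [apply Rmult_le_compat_l |]; lra. }
      assert (H4 : (1 + k) * d < c * k * eps) by lra.
      assert (H5 : (c * k) * Rabs (o' - o) < (c * k) * eps) by lra.
      apply Rmult_lt_reg_l in H5; [exact H5 | nra]. }
    split; [|split]; simpl.
    + change (Rabs (s' - s) < eps).
      assert (H4 : c * d < c * (k * eps)) by lra.
      apply Rmult_lt_reg_l in H4; [|exact Hc].
      apply Rmult_lt_reg_l with k; lra.
    + change (Rabs (o1' - o1) < eps); apply Hw; [nra | exact B1].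
    + change (Rabs (o2' - o2) < eps); apply Hw; [nra | exact B2].
Qed.

Definition complete_profile (a b c : R) (g : profile) : Prop :=
  (forall s, dom g s) /\ complete_solution a b c (px g) (pz g) (ptheta g).

Lemma px_lipschitz (a b c : R) (g : profile) (s s' : R) :
  complete_profile a b c g -> Rabs (px g s' - px g s) <= Rabs (s' - s).
Proof.
  intros [_ [_ H]]; rewrite <- (Rmult_1_l (Rabs (s' - s))).
  apply Rabs_mvt with (fun s => cos (ptheta g s)); [intros; apply H | intros; apply Rabs_le, COS_bound].
Qed.

Lemma unduloid_type_of_sin_gt (a b c : R) (g : profile) :
  a < 0 -> 0 < b -> complete_profile a b c g ->
  (forall s, b / (1 - a) * px g s < sin (ptheta g s)) -> unduloid_type g.
Proof.
  intros Ha Hb Hg Hsin; destruct (Hg) as [Hdom Hsol]; destruct (Hsol) as [Hc H].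
  assert (Hbe : 0 < b / (1 - a)) by (apply Rdiv_lt_0_compat; lra).
  set (k := b / (1 - a) * c); assert (Hk : 0 < k) by now apply Rmult_lt_0_compat.
  assert (Hk' : forall s, k <= sin (ptheta g s)).
  { intros s; specialize (Hsin s); destruct (H s) as [_ [_ Hx]]; unfold k; nra. }
  assert (Hz : forall p q, p < q -> k * (q - p) <= pz g q - pz g p).
  { intros p q Hpq.
    destruct (is_derive_mvt (pz g) (fun s => sin (ptheta g s)) p q Hpq) as [r [_ ->]].
    - intros; apply H.
    - apply Rmult_le_compat_r; [lra | apply Hk']. }
  split; [|split].
  - apply embedded_of_expanding_height with c k; auto; [apply H | | intros; now apply (px_lipschitz a b c)].
    intros s s'; destruct (Rtotal_order s s') as [Hlt | [-> | Hlt]].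
    + specialize (Hz s s' Hlt); rewrite !Rabs_pos_eq; nra.
    + rewrite !Rminus_diag, Rabs_R0; lra.
    + specialize (Hz s' s Hlt); rewrite (Rabs_minus_sym s'), (Rabs_minus_sym (pz g s')), !Rabs_pos_eq; nra.
  - apply misses_axis_of_lower_bound with c; auto; apply H.
  - destruct (cos_vanishes_after a b c (px g) (pz g) (ptheta g) Hsol 0 Ha Hb Hsin) as [s1 [_ H1]].
    (* Searching from [s1 + 1] makes the second zero distinct from the first. *)
    destruct (cos_vanishes_after a b c (px g) (pz g) (ptheta g) Hsol (s1 + 1) Ha Hb Hsin) as [s2 [H12 H2]].
    destruct (complete_periodic a b c (px g) (pz g) (ptheta g) Hsol s1 s2) as [L [T [HL [HT HLT]]]];
      auto; try lra.
    now apply axially_periodic_of_profile with L T.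
Qed.

Lemma nodoid_type_of_sin_lt (a b c : R) (g : profile) :
  a < 0 -> 0 < b -> complete_profile a b c g ->
  (forall s, sin (ptheta g s) < b / (1 - a) * px g s) -> nodoid_type g.
Proof.
  intros Ha Hb [Hdom Hsol] Hsin; destruct (Hsol) as [Hc H].
  assert (Hbe : 0 < b / (1 - a)) by (apply Rdiv_lt_0_compat; lra).
  assert (Hth : forall s, b / (1 - a) <= a * (sin (ptheta g s) / px g s) + b).
  { intros s; specialize (Hsin s); destruct (H s) as [[S0 _] _].
    assert (Hkap : sin (ptheta g s) / px g s < b / (1 - a)) by (apply Rlt_div_l; assumption).
    (* [be] is the fixed point of t -> a t + b, and this map is decreasing, so kappa_2 < be gives
       kappa_1 > be. *)
    assert (E : b = b / (1 - a) - a * (b / (1 - a))) by (field; lra).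
    rewrite E at 2; nra. }
  destruct (th_onto a b c (px g) (pz g) (ptheta g) Hsol _ (- (PI / 2)) Hbe Hth) as [s3 H3].
  destruct (th_onto a b c (px g) (pz g) (ptheta g) Hsol _ (PI / 2) Hbe Hth) as [s4 H4].
  destruct (complete_loop a b c (px g) (pz g) (ptheta g) Hsol s3 s4)
    as [s1 [s2 [H12 [Ex [Ez [Hsimple Hnear]]]]]]; auto.
  { intros s; specialize (Hth s); lra. }
  split; [|split; [|split]].
  - intros [Hinj _].
    assert (E : (s1, (1, 0)) = (s2, (1, 0))); [|injection E; lra].
    apply Hinj; try (split; [apply Hdom | unfold S1; simpl; ring]).
    unfold immersion; simpl; now rewrite Ex, Ez.
  - apply misses_axis_of_lower_bound with c; auto; apply H.
  - assert (C3 : cos (ptheta g s3) = 0) by now rewrite H3, cos_neg, cos_PI2.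
    assert (C4 : cos (ptheta g s4) = 0) by now rewrite H4, cos_PI2.
    assert (H34 : exists p q, p < q /\ cos (ptheta g p) = 0 /\ cos (ptheta g q) = 0).
    { generalize PI_RGT_0; intros HPI; destruct (Rtotal_order s3 s4) as [Hlt | [E | Hlt]].
      - now exists s3, s4.
      - subst s4; lra.
      - now exists s4, s3. }
    destruct H34 as [p [q [Hpq [Cp Cq]]]].
    destruct (complete_periodic a b c (px g) (pz g) (ptheta g) Hsol p q) as [L [T [HL [HT HLT]]]];
      auto; try lra.
    now apply axially_periodic_of_profile with L T.
  - exists s1, s2; split; [apply Hdom|]; split; [apply Hdom|]; split; [exact H12|].
    split; [now rewrite Ex, Ez|]; split; [|exact Hnear].
    intros s t Hs Hst Ht E; injection E as E1 E2; now apply Hsimple.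
Qed.

(** * Half circles and the round sphere *)

Lemma within_dom_proper (g : profile) (m : R) :
  (forall eps, 0 < eps -> exists s, dom g s /\ s <> m /\ Rabs (s - m) < eps) ->
  ProperFilter' (within (dom g) (Rbar_locally' m)).
Proof.
  intros H; constructor; [|apply within_filter, Rbar_locally'_filter].
  intros [eps Heps].
  destruct (H eps (cond_pos eps)) as [s [Hs [Hne Hball]]].
  exact (Heps s Hball Hne Hs).
Qed.

Lemma filterlim_within_dom (g : profile) (m : R) (f F : R -> R) :
  continuous F m -> (forall s, dom g s -> f s = F s) ->
  filterlim f (within (dom g) (Rbar_locally' m)) (locally (F m)).
Proof.
  intros HF Hf P HP.
  assert (H : locally m (fun s => P (F s))) by exact (HF P HP).
  unfold filtermap, within, Rbar_locally'; simpl; unfold locally', within.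
  revert H; apply filter_imp; intros s Hs _ Hdom; rewrite Hf; auto.
Qed.

(** [X] and [Z] continue the arc past its end [m], so the limits are their values there. The
    accumulation hypothesis makes the filter proper, hence the limit unique. *)
Lemma tends_to_axis_iff (g : profile) (m c : R) (X Z : R -> R) :
  (forall eps, 0 < eps -> exists s, dom g s /\ s <> m /\ Rabs (s - m) < eps) ->
  continuous X m -> continuous Z m -> (forall s, dom g s -> px g s = X s /\ pz g s = Z s) ->
  X m = 0 -> (tends_to_axis g m c <-> c = Z m).
Proof.
  intros Hnear HX HZ Hxz HX0; split.
  - intros [_ H].
    apply (filterlim_locally_unique (FF := within_dom_proper g m Hnear) (pz g) c (Z m) H).
    apply filterlim_within_dom; [exact HZ | intros; now apply Hxz].
  - intros ->; split.
    + rewrite <- HX0; apply filterlim_within_dom; [exact HX | intros; now apply Hxz].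
    + apply filterlim_within_dom; [exact HZ | intros; now apply Hxz].
Qed.

(** The half circle of radius 1/be centered on the axis at height cos t0 / be, a height chosen so
    that z vanishes at parameter 0. The interval is where the angle lies strictly between 0 and pi,
    that is, from pole to pole. *)
Definition circular_arc (be t0 : R) : profile :=
  Profile (- t0 / be) ((PI - t0) / be)
    (fun s => sin (t0 + be * s) / be) (fun s => cos t0 / be - cos (t0 + be * s) / be)
    (fun s => t0 + be * s).

Lemma dom_circular_arc (be t0 s : R) :
  0 < be -> dom (circular_arc be t0) s <-> 0 < t0 + be * s < PI.
Proof.
  intros Hbe; unfold dom; simpl.
  rewrite Rlt_div_l, <- Rlt_div_r by exact Hbe.
  split; intros; split; lra.
Qed.

Lemma circular_arc_solution (a be t0 : R) :
  0 < be -> weingarten_solution a ((1 - a) * be) (circular_arc be t0).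
Proof.
  intros Hbe; apply weingarten_solutionP; intros s Hs.
  rewrite dom_circular_arc in Hs by exact Hbe.
  assert (Hsin : 0 < sin (t0 + be * s)) by now apply sin_gt_0.
  split; [split; [|split]|]; simpl.
  - now apply Rdiv_lt_0_compat.
  - auto_derive; [auto|]; field; lra.
  - auto_derive; [auto|]; field; lra.
  - auto_derive; [auto|]; field; lra.
Qed.

Lemma solution_eq_circular_arc (a be t0 : R) (g : profile) :
  a < 0 -> 0 < be -> weingarten_solution a ((1 - a) * be) g -> dom g 0 ->
  pz g 0 = 0 -> ptheta g 0 = t0 -> sin t0 = be * px g 0 ->
  forall s, dom g s ->
    px g s = sin (t0 + be * s) / be /\
    pz g s = cos t0 / be - cos (t0 + be * s) / be /\
    ptheta g s = t0 + be * s.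
Proof.
  intros Ha Hbe Hsol H0 Hz0 Ht0 Hsin0 s Hs.
  assert (Hb : (1 - a) * be / (1 - a) = be) by (field; lra).
  assert (Hk : forall t, dom g t -> sin (ptheta g t) = be * px g t).
  { intros t Ht; destruct (first_integral_sign a _ g 0 t Ha Hsol H0 Ht) as [E _].
    rewrite Hb, Ht0 in E; lra. }
  rewrite weingarten_solutionP in Hsol.
  assert (Eth : Rabs ((ptheta g s - be * s) - (ptheta g 0 - be * 0)) <= 0 * Rabs (s - 0)).
  { apply (Rabs_mvt (fun s => ptheta g s - be * s) (fun _ => 0)).
    - intros t Ht; assert (Dt : dom g t) by now apply (dom_segment g 0 s).
      destruct (Hsol t Dt) as [[S0 [_ S2]] _].
      evar_last.
      + apply (is_derive_minus (ptheta g) (fun s => be * s)); [exact S2|].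
        apply (is_derive_scal (fun s => s)), @is_derive_id.
      + rewrite (Hk t Dt); unfold minus, plus, opp, one; simpl; field; lra.
    - intros; rewrite Rabs_R0; lra. }
  assert (Ez : Rabs ((pz g s + cos (ptheta g s) / be) - (pz g 0 + cos (ptheta g 0) / be)) <= 0 * Rabs (s - 0)).
  { apply (Rabs_mvt (fun s => pz g s + cos (ptheta g s) / be) (fun _ => 0)).
    - intros t Ht; assert (Dt : dom g t) by now apply (dom_segment g 0 s).
      destruct (Hsol t Dt) as [[S0 [_ S2]] S3].
      apply is_derive_ext with (fun s => pz g s + / be * cos (ptheta g s)).
      { intros; unfold Rdiv; simpl; ring. }
      evar_last.
      + apply (is_derive_plus (pz g) (fun s => / be * cos (ptheta g s))); [exact S3|].
        apply is_derive_scal, is_derive_cos_comp, S2.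
      + rewrite (Hk t Dt); unfold plus; simpl; field; lra.
    - intros; rewrite Rabs_R0; lra. }
  assert (E1 : ptheta g s = t0 + be * s).
  { rewrite Rmult_0_l, Ht0 in Eth; revert Eth; unfold Rabs; destruct Rcase_abs; lra. }
  rewrite <- E1; split; [|split; [|reflexivity]].
  - rewrite (Hk s Hs); field; lra.
  - rewrite Rmult_0_l, Ht0, Hz0 in Ez; revert Ez; unfold Rabs; destruct Rcase_abs; lra.
Qed.

(** If [g] contained an end of the arc, its x would vanish there. So the arc extends [g], and
    maximality makes the two intervals equal. *)
Lemma maximal_circular_arc (a be t0 : R) (g : profile) :
  a < 0 -> 0 < be -> maximal_solution a ((1 - a) * be) g -> dom g 0 ->
  pz g 0 = 0 -> ptheta g 0 = t0 -> sin t0 = be * px g 0 -> 0 < t0 < PI ->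
  lo g = lo (circular_arc be t0) /\ hi g = hi (circular_arc be t0).
Proof.
  intros Ha Hbe [Hsol Hmax] H0 Hz0 Ht0 Hsin0 Ht0'.
  assert (Heq := solution_eq_circular_arc a be t0 g Ha Hbe Hsol H0 Hz0 Ht0 Hsin0).
  assert (Hx : forall s, dom g s -> 0 < px g s).
  { intros s Hs; now apply Hsol. }
  destruct (Hmax (circular_arc be t0) (circular_arc_solution a be t0 Hbe)) as [El Er]; [|now split].
  split; [|split].
  - apply Rbar_not_lt_le; intros Hlt; simpl in Hlt.
    assert (Hd : dom g (- t0 / be)).
    { split; [exact Hlt|]; apply Rbar_le_lt_trans with 0; [|apply H0]; simpl.
      apply Rle_div_l; lra. }
    specialize (Hx _ Hd); destruct (Heq _ Hd) as [E _].
    replace (t0 + be * (- t0 / be)) with 0 in E by (field; lra).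
    rewrite sin_0 in E; unfold Rdiv in E; lra.
  - apply Rbar_not_lt_le; intros Hlt; simpl in Hlt.
    assert (Hd : dom g ((PI - t0) / be)).
    { split; [|exact Hlt]; apply Rbar_lt_le_trans with 0; [apply H0|]; simpl.
      apply Rdiv_le_0_compat; lra. }
    specialize (Hx _ Hd); destruct (Heq _ Hd) as [E _].
    replace (t0 + be * ((PI - t0) / be)) with PI in E by (field; lra).
    rewrite sin_PI in E; unfold Rdiv in E; lra.
  - intros s Hs; simpl; destruct (Heq s Hs) as [E1 [E2 E3]]; now rewrite E1, E2, E3.
Qed.

Lemma round_sphere_of_circular_arc (be t0 : R) (g : profile) :
  0 < be -> 0 < t0 < PI ->
  lo g = lo (circular_arc be t0) -> hi g = hi (circular_arc be t0) ->
  (forall s, dom g s ->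
    px g s = px (circular_arc be t0) s /\ pz g s = pz (circular_arc be t0) s) ->
  round_sphere g.
Proof.
  intros Hbe Ht0 Hlo Hhi Heq; assert (HPI := PI_RGT_0).
  assert (Hdom : forall s, dom g s <-> 0 < t0 + be * s < PI).
  { intros s; rewrite <- dom_circular_arc by exact Hbe; unfold dom; now rewrite Hlo, Hhi. }
  set (z0 := cos t0 / be); set (r := / be); assert (Hr : 0 < r) by now apply Rinv_0_lt_compat.
  assert (Hber : be * r = 1) by (unfold r; field; lra).
  set (X := px (circular_arc be t0)) in *; set (Z := pz (circular_arc be t0)) in *.
  assert (HX : forall s, continuous X s).
  { intros s; apply (ex_derive_continuous X); unfold X; simpl; auto_derive; lra. }
  assert (HZ : forall s, continuous Z s).
  { intros s; apply (ex_derive_continuous Z); unfold Z; simpl; auto_derive; lra. }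
  assert (Hl : forall c, tends_to_axis g (lo g) c <-> c = z0 - r).
  { intros c; rewrite Hlo; simpl.
    assert (E : t0 + be * (- t0 / be) = 0) by (field; lra).
    replace (z0 - r) with (Z (- t0 / be)).
    - apply tends_to_axis_iff with X; auto.
      (* The cap [r * PI / 2] lets the angle turn by at most pi/2, so the sample point does not
         leave the domain at the other pole. *)
      + intros eps Heps; exists (- t0 / be + Rmin (eps / 2) (r * PI / 2)).
        assert (H1 : 0 < Rmin (eps / 2) (r * PI / 2)) by (apply Rmin_case; nra).
        assert (H2 := Rmin_l (eps / 2) (r * PI / 2)); assert (H3 := Rmin_r (eps / 2) (r * PI / 2)).
        revert H1 H2 H3; generalize (Rmin (eps / 2) (r * PI / 2)); intros d H1 H2 H3.
        rewrite Hdom, Rmult_plus_distr_l, <- Rplus_assoc, E.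
        split; [|split; [lra|]].
        * assert (be * d <= be * (r * PI / 2)) by (apply Rmult_le_compat_l; lra).
          replace (be * (r * PI / 2)) with ((be * r) * PI / 2) in H by (unfold Rdiv; ring).
          rewrite Hber in H; split; nra.
        * replace (- t0 / be + d - - t0 / be) with d by ring; rewrite Rabs_pos_eq; lra.
      + unfold X; simpl; rewrite E, sin_0; unfold Rdiv; ring.
    - unfold Z; simpl; rewrite E, cos_0; unfold z0, r; field; lra. }
  assert (Hh : forall c, tends_to_axis g (hi g) c <-> c = z0 + r).
  { intros c; rewrite Hhi; simpl.
    assert (E : t0 + be * ((PI - t0) / be) = PI) by (field; lra).
    replace (z0 + r) with (Z ((PI - t0) / be)).
    - apply tends_to_axis_iff with X; auto.
      + intros eps Heps; exists ((PI - t0) / be - Rmin (eps / 2) (r * PI / 2)).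
        assert (H1 : 0 < Rmin (eps / 2) (r * PI / 2)) by (apply Rmin_case; nra).
        assert (H2 := Rmin_l (eps / 2) (r * PI / 2)); assert (H3 := Rmin_r (eps / 2) (r * PI / 2)).
        revert H1 H2 H3; generalize (Rmin (eps / 2) (r * PI / 2)); intros d H1 H2 H3.
        rewrite Hdom; unfold Rminus at 1 4; rewrite Rmult_plus_distr_l, <- Rplus_assoc, E.
        split; [|split; [lra|]].
        * assert (be * d <= be * (r * PI / 2)) by (apply Rmult_le_compat_l; lra).
          replace (be * (r * PI / 2)) with ((be * r) * PI / 2) in H by (unfold Rdiv; ring).
          rewrite Hber in H; split; nra.
        * replace ((PI - t0) / be - d - (PI - t0) / be) with (- d) by ring.
          rewrite Rabs_Ropp, Rabs_pos_eq; lra.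
      + unfold X; simpl; rewrite E, sin_PI; unfold Rdiv; ring.
    - unfold Z; simpl; rewrite E, cos_PI; unfold z0, r; field; lra. }
  assert (Hcurve : forall u w, on_curve g (u, w) <-> 0 <= u /\ u ^ 2 + (w - z0) ^ 2 = r ^ 2).
  { intros u w; split.
    - intros [[s [Hs E]] | [c [Hc E]]]; injection E as -> ->.
      + destruct (Heq s Hs) as [-> ->]; unfold X, Z; simpl; fold z0.
        rewrite Hdom in Hs; split.
        * apply Rdiv_le_0_compat; [left; now apply sin_gt_0 | exact Hbe].
        * generalize (sin2_cos2 (t0 + be * s)); unfold Rsqr, r; intros E.
          replace (z0 - cos (t0 + be * s) / be - z0) with (- (cos (t0 + be * s) / be)) by ring.
          apply Rmult_eq_reg_l with (be ^ 2); [|apply pow_nonzero; lra].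
          field_simplify; [|lra|lra]; lra.
      + split; [lra|]; rewrite Hl, Hh in Hc; destruct Hc as [-> | ->]; ring.
    - intros [[Hu | <-] E].
      (* [C] is the cosine of the angle sought; since its sine is be u > 0, acos C lies strictly
         between 0 and pi. *)
      + left; set (C := be * (z0 - w)).
        assert (EC : (be * u) ^ 2 + C ^ 2 = 1).
        { unfold C; replace 1 with (be ^ 2 * r ^ 2) by (rewrite <- Rpow_mult_distr, Hber; ring).
          rewrite <- E; ring. }
        assert (Hbu : 0 < be * u) by now apply Rmult_lt_0_compat.
        assert (HC : -1 <= C <= 1) by (split; nra).
        assert (Hcos : cos (acos C) = C) by now apply cos_acos.
        assert (Hsin : sin (acos C) = be * u).
        { rewrite sin_acos by exact HC; rewrite <- (sqrt_Rsqr (be * u)) by lra.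
          f_equal; unfold Rsqr; nra. }
        assert (Eph : t0 + be * ((acos C - t0) / be) = acos C) by (field; lra).
        assert (Hd : dom g ((acos C - t0) / be)).
        { rewrite Hdom, Eph; destruct (acos_bound C) as [[H1 | H1] [H2 | H2]].
          - now split.
          - rewrite H2, sin_PI in Hsin; lra.
          - rewrite <- H1, sin_0 in Hsin; lra.
          - lra. }
        exists ((acos C - t0) / be); split; [exact Hd|].
        destruct (Heq _ Hd) as [-> ->]; unfold X, Z; simpl.
        rewrite Eph, Hsin, Hcos; unfold C; fold z0; f_equal; field; lra.
      + right; exists w; split; [|reflexivity].
        rewrite Hl, Hh.
        assert (Hw : (w - (z0 - r)) * (w - (z0 + r)) = 0) by lra.
        apply Rmult_integral in Hw as [Hw | Hw]; [left | right]; lra. }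
  exists z0, r; split; [exact Hr|]; intros u v w; split.
  - intros [[p q] [[o1 o2] [Hq [Ho E]]]]; unfold S1 in Ho; simpl in Ho, E.
    injection E as -> -> ->; apply Hcurve in Hq as [_ Hq].
    rewrite <- Hq; replace (p ^ 2) with (p ^ 2 * (o1 * (o1 * 1) + o2 * (o2 * 1))) by (rewrite Ho; ring).
    ring.
  - intros E; set (p := sqrt (u ^ 2 + v ^ 2)).
    assert (Hp2 : p ^ 2 = u ^ 2 + v ^ 2).
    { unfold p; apply pow2_sqrt; generalize (pow2_ge_0 u) (pow2_ge_0 v); lra. }
    assert (Hp0 : 0 <= p) by apply sqrt_pos.
    assert (Hc : on_curve g (p, w)) by (apply Hcurve; split; [exact Hp0 | rewrite Hp2; exact E]).
    destruct Hp0 as [Hp0 | Hp0].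
    + exists (p, w), (u / p, v / p); split; [exact Hc|]; split.
      * unfold S1; simpl fst; simpl snd.
        apply Rmult_eq_reg_l with (p ^ 2); [|apply pow_nonzero; lra].
        rewrite Rmult_1_r.
        replace (p ^ 2 * ((u / p) ^ 2 + (v / p) ^ 2)) with (u ^ 2 + v ^ 2) by (field; lra); lra.
      * simpl; f_equal; f_equal; field; lra.
    + rewrite <- Hp0 in Hp2, Hc.
      assert (Hu : u = 0 /\ v = 0).
      { generalize (pow2_ge_0 u) (pow2_ge_0 v); intros.
        split; apply Rsqr_0_uniq; rewrite Rsqr_pow2; lra. }
      destruct Hu as [-> ->].
      exists (0, w), (1, 0); split; [exact Hc|]; split; [unfold S1; simpl; ring|].
      simpl; f_equal; f_equal; ring.
Qed.

Lemma types_of_positive_b (a b x0 theta0 : R) (g : profile) :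
  a < 0 -> 0 < b -> 0 < x0 -> 0 <= theta0 <= 2 * PI -> generating_curve a b x0 theta0 g ->
  unduloid_type g \/ round_sphere g \/ nodoid_type g.
Proof.
  intros Ha Hb Hx0 Ht0 [H0 [Hmax [Ex [Ez Et]]]]; destruct (Hmax) as [Hsol _].
  set (be := b / (1 - a)); assert (Hbe : 0 < be) by (apply Rdiv_lt_0_compat; lra).
  assert (Eb : b = (1 - a) * be) by (unfold be; field; lra).
  destruct (Req_dec (sin (ptheta g 0) - be * px g 0) 0) as [E0 | E0].
  - right; left.
    assert (Hs0 : 0 < sin theta0).
    { rewrite Et, Ex in E0; generalize (Rmult_lt_0_compat _ _ Hbe Hx0); lra. }
    assert (Ht0' : 0 < theta0 < PI).
    { split.
      - destruct Ht0 as [[Hp | E] _]; [exact Hp | rewrite <- E, sin_0 in Hs0; lra].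
      - apply Rnot_le_lt; intros Hle; generalize (sin_le_0 theta0 Hle (proj2 Ht0)); lra. }
    rewrite Eb in Hmax, Hsol.
    assert (Es : sin theta0 = be * px g 0) by (rewrite <- Et; lra).
    destruct (maximal_circular_arc a be theta0 g Ha Hbe Hmax H0 Ez Et Es Ht0') as [El Er].
    apply (round_sphere_of_circular_arc be theta0); auto.
    intros s Hs.
    destruct (solution_eq_circular_arc a be theta0 g Ha Hbe Hsol H0 Ez Et Es s Hs) as [E1 [E2 _]].
    now split.
  - destruct (px_lower_bound a b g 0 Ha Hb Hsol H0 E0) as [c [Hc Hxc]].
    assert (Hdom := maximal_solution_complete a b c g 0 Hc H0 Hmax Hxc).
    assert (Hg : complete_profile a b c g).
    { split; [exact Hdom|]; split; [exact Hc|]; intros s.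
      rewrite weingarten_solutionP in Hsol; destruct (Hsol s (Hdom s)) as [S1 S2].
      split; [exact S1|]; split; [exact S2 | apply Hxc, Hdom]. }
    destruct (Rlt_dec 0 (sin (ptheta g 0) - be * px g 0)) as [Hp | Hn].
    + left; apply unduloid_type_of_sin_gt with a b c; auto; intros s.
      destruct (first_integral_sign a b g 0 s Ha Hsol H0 (Hdom s)) as [_ [H _]].
      fold be in H |- *; specialize (H Hp); lra.
    + right; right; apply nodoid_type_of_sin_lt with a b c; auto; intros s.
      destruct (first_integral_sign a b g 0 s Ha Hsol H0 (Hdom s)) as [_ [_ H]].
      fold be in H |- *; specialize (H ltac:(lra)); lra.
Qed.

(** * Reflection in the plane z = 0 *)

(* The angle is [2 * PI - theta] rather than [- theta] so that it stays in [0, 2 * PI]. *)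
Definition mirror (g : profile) : profile :=
  Profile (lo g) (hi g) (px g) (fun s => - pz g s) (fun s => 2 * PI - ptheta g s).

(** As [mirror] is an involution, each property below needs to be transferred in one direction
    only. *)
Lemma mirrorK (g : profile) : mirror (mirror g) = g.
Proof.
  destruct g as [l h x z t]; unfold mirror; simpl.
  f_equal; apply functional_extensionality; intros s; ring.
Qed.

Lemma sin_2PI_minus (t : R) : sin (2 * PI - t) = - sin t.
Proof. rewrite sin_minus, sin_2PI, cos_2PI; ring. Qed.

Lemma cos_2PI_minus (t : R) : cos (2 * PI - t) = cos t.
Proof. rewrite cos_minus, sin_2PI, cos_2PI; ring. Qed.

Lemma mirror_weingarten_solution (a b : R) (g : profile) :
  weingarten_solution a b g -> weingarten_solution a (- b) (mirror g).
Proof.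
  rewrite !weingarten_solutionP; intros H s Hs.
  destruct (H s Hs) as [[S0 [S1 S2]] S3].
  unfold solves; simpl; rewrite sin_2PI_minus, cos_2PI_minus.
  split; [split; [exact S0|]; split; [exact S1|]|].
  - evar_last.
    + apply (is_derive_minus (fun _ => 2 * PI) (ptheta g)); [apply @is_derive_const | exact S2].
    + unfold minus, plus, opp, zero; simpl; field; lra.
  - apply (is_derive_opp (pz g)), S3.
Qed.

(** An extension of the mirror image reflects back to an extension of [g] with the same interval. *)
Lemma mirror_maximal_solution (a b : R) (g : profile) :
  maximal_solution a b g -> maximal_solution a (- b) (mirror g).
Proof.
  intros [Hsol Hmax]; split; [now apply mirror_weingarten_solution|].
  intros h Hh [Hl [Hr He]].
  apply (Hmax (mirror h)).
  - rewrite <- (Ropp_involutive b); now apply mirror_weingarten_solution.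
  - split; [exact Hl|]; split; [exact Hr|]; intros s Hs.
    destruct (He s Hs) as [E1 [E2 E3]]; simpl in *; rewrite E1, E2, E3.
    split; [reflexivity|]; split; ring.
Qed.

Lemma mirror_embedded (g : profile) : embedded g -> embedded (mirror g).
Proof.
  intros [Hinj Hcont]; split.
  - intros q q' Hq Hq' E; apply Hinj; auto.
    unfold immersion in *; simpl in E; injection E as E1 E2 E3.
    apply Ropp_eq_compat in E3; rewrite !Ropp_involutive in E3; now rewrite E1, E2, E3.
  - intros q Hq eps; destruct (Hcont q Hq eps) as [delta Hd]; exists delta; intros q' Hq' [B12 B3].
    apply Hd; [exact Hq'|]; split; [exact B12|].
    change (Rabs (- pz g (fst q') - - pz g (fst q)) < delta) in B3.
    change (Rabs (pz g (fst q') - pz g (fst q)) < delta).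
    replace (- pz g (fst q') - - pz g (fst q)) with (- (pz g (fst q') - pz g (fst q))) in B3 by ring.
    now rewrite Rabs_Ropp in B3.
Qed.

Lemma mirror_tends_to_axis (g : profile) (e : Rbar) (c : R) :
  tends_to_axis g e c -> tends_to_axis (mirror g) e (- c).
Proof.
  intros [Hx Hz]; split; [exact Hx|].
  apply (filterlim_comp _ _ _ (pz g) Ropp _ (locally c)); [exact Hz|].
  apply (filterlim_opp (V := R_NormedModule)).
Qed.

Lemma mirror_on_surface (g : profile) (u v w : R) :
  on_surface g (u, v, w) -> on_surface (mirror g) (u, v, - w).
Proof.
  intros [[p q] [o [Hq [Ho E]]]]; simpl in E; injection E as -> -> ->.
  exists (p, - q), o; split; [|now split].
  destruct Hq as [[s [Hs E]] | [c [Hc E]]]; injection E as -> ->.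
  - left; now exists s.
  - right; exists (- c); split; [|reflexivity].
    destruct Hc as [Hc | Hc]; [left | right]; now apply mirror_tends_to_axis.
Qed.

Lemma mirror_misses_axis (g : profile) : misses_axis g -> misses_axis (mirror g).
Proof.
  intros H u v w Hs; apply mirror_on_surface in Hs; rewrite mirrorK in Hs; now apply (H u v (- w)).
Qed.

Lemma mirror_axially_periodic (g : profile) : axially_periodic g -> axially_periodic (mirror g).
Proof.
  intros [L [T [HL [HT H]]]]; exists L, (- T); split; [exact HL|]; split; [lra|].
  intros s Hs; destruct (H s Hs) as [H1 [H2 H3]]; split; [exact H1|]; split; [exact H2|].
  intros w Hw; specialize (H3 w Hw); unfold immersion in *; simpl in *.
  injection H3 as E1 E2 E3; rewrite E1, E2, E3; f_equal; ring.
Qed.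

Lemma mirror_unduloid_type (g : profile) : unduloid_type g -> unduloid_type (mirror g).
Proof.
  intros [H1 [H2 H3]].
  split; [|split]; auto using mirror_embedded, mirror_misses_axis, mirror_axially_periodic.
Qed.

Lemma mirror_nodoid_type (g : profile) : nodoid_type g -> nodoid_type (mirror g).
Proof.
  intros [H1 [H2 [H3 [s1 [s2 [D1 [D2 [H12 [E [Hs Hn]]]]]]]]]].
  split; [intros Hm; apply H1; rewrite <- (mirrorK g); now apply mirror_embedded|].
  split; [now apply mirror_misses_axis|]; split; [now apply mirror_axially_periodic|].
  exists s1, s2; split; [exact D1|]; split; [exact D2|]; split; [exact H12|]; simpl.
  injection E as E1 E2; split; [now rewrite E1, E2|]; split; [|exact Hn].
  intros s t Hs1 Hst Hs2 Est; injection Est as Est1 Est2; apply Hs; auto.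
  apply Ropp_eq_compat in Est2; rewrite !Ropp_involutive in Est2; now rewrite Est1, Est2.
Qed.

Lemma mirror_round_sphere (g : profile) : round_sphere g -> round_sphere (mirror g).
Proof.
  intros [c [r [Hr H]]]; exists (- c), r; split; [exact Hr|]; intros u v w.
  replace ((w - - c) ^ 2) with ((- w - c) ^ 2) by ring; rewrite <- H; split; intros Hs;
    apply mirror_on_surface in Hs.
  - now rewrite mirrorK in Hs.
  - now rewrite Ropp_involutive in Hs.
Qed.

Theorem theorem5p2 (a b : R) (ha : a < 0) (hb : b <> 0)
  (x0 theta0 : R) (hx0 : 0 < x0) (htheta0 : 0 <= theta0 < 2 * PI)
  (g : profile) (hg : generating_curve a b x0 theta0 g) :
  unduloid_type g \/ circular_cylinder g \/ round_sphere g \/ nodoid_type g.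
Proof.
  destruct (Rlt_dec 0 b) as [Hb | Hb].
  - destruct (types_of_positive_b a b x0 theta0 g) as [H | [H | H]]; auto; lra.
  - destruct hg as [H0 [Hmax [Ex [Ez Et]]]].
    destruct (types_of_positive_b a (- b) x0 (2 * PI - theta0) (mirror g)) as [H | [H | H]];
      auto; try lra.
    + split; [exact H0|]; split; [now apply mirror_maximal_solution|].
      simpl; rewrite Ex, Ez, Et; split; [reflexivity|]; split; ring.
    + left; rewrite <- (mirrorK g); now apply mirror_unduloid_type.
    + right; right; left; rewrite <- (mirrorK g); now apply mirror_round_sphere.
    + right; right; right; rewrite <- (mirrorK g); now apply mirror_nodoid_type.
Qed.
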